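(* Let $\varphi=\frac12+\frac{\sqrt5}{2}$ and $\bar\varphi=\frac12-\frac{\sqrt5}{2}$. Let $A$ be a maximal indecomposable cyclotomic matrix over the ring $\mathbb{Z}[\varphi]$ which is not a matrix over $\mathbb{Z}$. Then $A$ is equivalent to the adjacency matrix of one of the following weighted graphs (all unlisted edge weights and charges are $0$): (1) $S_3$: vertices $a,b,c$ with charges $\varphi,\bar\varphi,1$; edges $ac$ of weight $\bar\varphi$, $cb$ of weight $\varphi$, $ab$ of weight $1$. (2) $S_4^{(1,\varphi)}$: vertices $a,b,c,d$ with charges $1,-1,-1,1$; edges $ab$ of weight $\varphi$, $ac$ of weight $\bar\varphi$, $bd$ of weight $\bar\varphi$, $cd$ of weight $-\varphi$. (3) $S_4^{(2,\varphi)}$: vertices $a,b,c,d$ with charges $\varphi,-\varphi,-\varphi,\varphi$; edges $ac$ and $bd$ of weight $\bar\varphi$, $ab$ of weight $1$, $cd$ of weight $-1$. (4) $S_4^{(3,\varphi)}$: vertices $a,b,c,d$ with charges $0,\varphi,\bar\varphi,-1$; edges $ab$ of weight $\bar\varphi$, $ac$ of weight $\varphi$, and $bd$, $cd$, $ad$ of weight $1$. (5) $S_6$: vertices $a,b,c,d,e,f$, all uncharged; edges $ab$, $cd$, $ef$ of weight $\varphi$, $be$, $ad$, $cf$ of weight $\bar\varphi$, and $bc$, $de$, $af$ of weight $1$. (6) $S_8^{\dag\dag}$: vertices $a,\dots,h$, all uncharged; edges $ab$, $ef$, $gh$ of weight $\bar\varphi$, $cd$ of weight $-\bar\varphi$,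 $cg$, $ae$, $dh$ of weight $\varphi$, $bf$ of weight $-\varphi$, $bd$, $fh$, $ac$ of weight $1$, and $eg$ of weight $-1$. (7) $S_8^\ddag$: vertices $a,\dots,h$, all uncharged; edges $ab$, $cg$, $fh$ of weight $\varphi$, $bf$, $gh$, $ac$ of weight $\bar\varphi$, $ef$, $cd$, $bd$, $eg$, $ae$, $dh$ of weight $1$, and $de$ of weight $-1$. Moreover, every indecomposable cyclotomic $\mathbb{Z}[\varphi]$-matrix is contained (as a principal submatrix) in a maximal one.
   Context: A real symmetric matrix $A$ is cyclotomic if its characteristic polynomial $\det(xI-A)$ has integer coefficients and all its eigenvalues lie in $[-2,2]$. A square matrix is indecomposable if it is not equivalent (in the sense below) to a block diagonal matrix with more than one block, equivalently its underlying graph (vertices $u\neq v$ adjacent iff $a_{uv}\ne0$) is connected. A maximal indecomposable cyclotomic matrix over a ring $T$ is an indecomposable cyclotomic $T$-matrix that is not a proper principal submatrix of any indecomposable cyclotomic $T$-matrix. Equivalence: with $K=\mathbb{Q}(\sqrt5)$, $A$ is strongly equivalent to $B$ if $A=\sigma(QBQ^\top)$ for some $Q\in O_n(\mathbb{Z})$ (signed permutation matrix) and some $\sigma\in\operatorname{Gal}(K/\mathbb{Q})$ applied entrywise; $A$ and $B$ are equivalent if $A$ is strongly equivalent to $B$ or to $-B$. The adjacency matrix of a weighted graph has $(u,v)$ entry the weight of edge $uv$ (zero if absent) and $(v,v)$ entry the charge of $v$. *)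

(* Defs.v *)
From HB Require Import structures.
From mathcomp Require Import all_boot all_order all_algebra.
Set Implicit Arguments. Unset Strict Implicit. Unset Printing Implicit Defensive.
Import Order.TTheory GRing.Theory Num.Theory.
Local Open Scope ring_scope.

Section Defs.
Variable R : rcfType.

Definition phi : R := (1 + Num.sqrt 5) / 2.
Definition phib : R := (1 - Num.sqrt 5) / 2.

Definition imx {n m : nat} (A : 'M[int]_(n, m)) : 'M[R]_(n, m) :=
  \matrix_(i, j) (A i j)%:~R.

Definition in_Zphi (x : R) : Prop := exists a b : int, x = a%:~R + b%:~R * phi.
Definition in_Z (x : R) : Prop := exists a : int, x = a%:~R.

Definition over_Zphi {n} (A : 'M[R]_n) : Prop := forall i j, in_Zphi (A i j).
Definition over_Z {n} (A : 'M[R]_n) : Prop := forall i j, in_Z (A i j).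

Definition cyclotomic {n} (A : 'M[R]_n) : Prop :=
  A^T = A /\
  (exists p : {poly int}, char_poly A = map_poly (fun z : int => z%:~R) p) /\
  (forall x : R, root (char_poly A) x -> -2 <= x <= 2).

Definition mx_adj {n} (A : 'M[R]_n) : rel 'I_n := fun i j => (i != j) && (A i j != 0).

Definition indecomposable {n} (A : 'M[R]_n) : Prop :=
  (0 < n)%N /\ forall i j : 'I_n, connect (mx_adj A) i j.

Definition principal_sub {n m} (A : 'M[R]_n) (B : 'M[R]_m) : Prop :=
  exists f : 'I_n -> 'I_m, injective f /\ A = \matrix_(i, j) B (f i) (f j).

Definition indec_cyc_Zphi {n} (A : 'M[R]_n) : Prop :=
  over_Zphi A /\ indecomposable A /\ cyclotomic A.

Definition maximal_indec_cyc_Zphi {n} (A : 'M[R]_n) : Prop :=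
  indec_cyc_Zphi A /\
  ~ (exists (m : nat) (B : 'M[R]_m), indec_cyc_Zphi B /\ (n < m)%N /\ principal_sub A B).

(* N = sigma(M) for the nontrivial element sigma of Gal(Q(sqrt5)/Q),
   applied entrywise to the Z[phi]-matrix M (sigma(phi) = phib) *)
Definition galois_conj {n} (M N : 'M[R]_n) : Prop :=
  exists A1 A2 : 'M[int]_n,
    M = imx A1 + phi *: imx A2 /\ N = imx A1 + phib *: imx A2.

(* A = sigma(Q B Q^T) with Q in O_n(Z) (an integer matrix with Q Q^T = 1
   and Q^T Q = 1; stated for rectangular Q, which forces n = m) and
   sigma in Gal(K/Q) *)
Definition strongly_equiv {n m} (A : 'M[R]_n) (B : 'M[R]_m) : Prop :=
  exists Q : 'M[int]_(n, m),
    Q *m Q^T = 1%:M /\ Q^T *m Q = 1%:M /\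
    (A = imx Q *m B *m (imx Q)^T \/ galois_conj (imx Q *m B *m (imx Q)^T) A).

Definition mx_equiv {n m} (A : 'M[R]_n) (B : 'M[R]_m) : Prop :=
  strongly_equiv A B \/ strongly_equiv A (- B).

(* adjacency matrix of a weighted graph on vertices 0..k-1:
   charges ch (vertex i has charge nth 0 ch i), edges es given as
   (u, v, weight), each edge listed once *)
Definition wgraph (k : nat) (ch : seq R) (es : seq (nat * nat * R)) : 'M[R]_k :=
  \matrix_(i, j)
    if i == j then nth 0 ch i
    else \sum_(e <- es | ((e.1.1 == i) && (e.1.2 == j)) || ((e.1.1 == j) && (e.1.2 == i))) e.2.

(* vertices a,b,c,... = 0,1,2,... *)
Definition S3 : 'M[R]_3 :=
  wgraph 3 [:: phi; phib; 1] [:: (0%N, 2%N, phib); (2%N, 1%N, phi); (0%N, 1%N, 1)].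
Definition S4_1 : 'M[R]_4 :=
  wgraph 4 [:: 1; -1; -1; 1]
    [:: (0%N, 1%N, phi); (0%N, 2%N, phib); (1%N, 3%N, phib); (2%N, 3%N, - phi)].
Definition S4_2 : 'M[R]_4 :=
  wgraph 4 [:: phi; - phi; - phi; phi]
    [:: (0%N, 2%N, phib); (1%N, 3%N, phib); (0%N, 1%N, 1); (2%N, 3%N, -1)].
Definition S4_3 : 'M[R]_4 :=
  wgraph 4 [:: 0; phi; phib; -1]
    [:: (0%N, 1%N, phib); (0%N, 2%N, phi); (1%N, 3%N, 1); (2%N, 3%N, 1); (0%N, 3%N, 1)].
Definition S6 : 'M[R]_6 :=
  wgraph 6 [::]
    [:: (0%N, 1%N, phi); (2%N, 3%N, phi); (4%N, 5%N, phi);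
        (1%N, 4%N, phib); (0%N, 3%N, phib); (2%N, 5%N, phib);
        (1%N, 2%N, 1); (3%N, 4%N, 1); (0%N, 5%N, 1)].
Definition S8_dagdag : 'M[R]_8 :=
  wgraph 8 [::]
    [:: (0%N, 1%N, phib); (4%N, 5%N, phib); (6%N, 7%N, phib); (2%N, 3%N, - phib);
        (2%N, 6%N, phi); (0%N, 4%N, phi); (3%N, 7%N, phi); (1%N, 5%N, - phi);
        (1%N, 3%N, 1); (5%N, 7%N, 1); (0%N, 2%N, 1); (4%N, 6%N, -1)].
Definition S8_ddag : 'M[R]_8 :=
  wgraph 8 [::]
    [:: (0%N, 1%N, phi); (2%N, 6%N, phi); (5%N, 7%N, phi);
        (1%N, 5%N, phib); (6%N, 7%N, phib); (0%N, 2%N, phib);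
        (4%N, 5%N, 1); (2%N, 3%N, 1); (1%N, 3%N, 1); (4%N, 6%N, 1); (0%N, 4%N, 1); (3%N, 7%N, 1);
        (3%N, 4%N, -1)].

End Defs.

(* Main.v *)
(** A cyclotomic matrix [A] over Z[phi] and its Galois conjugate have the same characteristic
    polynomial, so [|A x| <= 2 |x|] in both real embeddings.  Conversely a symmetric [B] with
    [B^2 = 4 I] is cyclotomic, and maximal if it is indecomposable.

    If [A] is irrational, an irrational vertex or edge is grown vertex by vertex.  Only 59 matrices
    occur up to equivalence, all of them principal submatrices of the seven graphs, whose adjacency
    matrices have square [4 I]: every other extension violates the norm bound for a vector obtained
    by power iteration.  This is a finite computation.

    The only other matrices that could lie in no maximal one are the large integral ones.  If [A] is
    integral then [|A x| <= 2 |x|] makes [A] the matrix of inner products [(a_i, b_j)] of two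
    orthogonal families of roots, exchanged by an isometry.  If [A] is large the root lattice is of
    type A or D, hence the roots are [+-e_s +- e_t] and the isometry is a signed permutation [P].
    Completing the [a_i] to an orthogonal frame [V] yields the matrix [V P V^T], with square [4 I],
    that contains [A]. *)

From Stdlib Require Import ZArith Classical.
Require Import Defs.
From HB Require Import structures.
From mathcomp Require Import all_boot all_order all_algebra.
From mathcomp Require Import complex.
From mathcomp Require Import ring lra zify ssrZ.
Set Implicit Arguments. Unset Strict Implicit. Unset Printing Implicit Defensive.
Import Order.TTheory GRing.Theory Num.Theory.
Local Open Scope ring_scope.

(** * Quadratic forms of cyclotomic matrices *)

(** The obstacle in the integral case is the exceptional root lattices. They are excluded not by a
    classification but by size: all degrees are at most 4, so more than [5 ^ 7] vertices force an
    induced path with nine of them, that is, a root lattice of type A on ten coordinates. Each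
    further root is known only through its inner products with the earlier ones, and the point is
    that an integral vector of norm at most 2 has these inner products. Ten coordinates are just
    enough: over the nine coordinates of A_8 this fails for the further roots of E_8.

    The two families of roots form a connected system only if the bipartite double cover of the
    graph of [A] is connected. Otherwise [A] is bipartite without charges, and each colour class
    gets its own copy of the root system of [2 + A].

    A maximal orthogonal set of roots may miss a coordinate, and a single missed coordinate leaves
    no room for a vector of norm 2. Hence the frame is completed in two copies of the space, where a
    missed coordinate is paired with its copy. *)

Definition nsq (R : comNzRingType) n (x : 'cV[R]_n) : R := (x^T *m x) 0 0.

Lemma nsqE (R : comNzRingType) n (x : 'cV[R]_n) : nsq x = \sum_i x i 0 ^+ 2.
Proof. by rewrite /nsq mxE; apply: eq_bigr => i _; rewrite mxE expr2. Qed.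

Definition contraction2 (R : numDomainType) n (A : 'M[R]_n) :=
  forall x : 'cV_n, nsq (A *m x) <= 4 * nsq x.

Section Spectral.
Import ComplexField.
Local Open Scope sesquilinear_scope.
Local Open Scope complex_scope.
Variable R : rcfType.

(** In an orthonormal eigenbasis over [R[i]], where [x] has coordinates [y], the difference of the
    two sides is the sum of [(4 - d_i ^ 2) |y_i| ^ 2], and the eigenvalues [d_i] are real. *)
Lemma contraction2_of_roots n (A : 'M[R]_n) : A^T = A ->
  (forall x, root (char_poly A) x -> -2 <= x <= 2) -> contraction2 A.
Proof.
move=> symA rootA x.
pose f : {rmorphism R -> R[i]} := real_complex R; pose Ac := map_mx f A.
have herm : Ac \is hermsymmx.
  apply: realsym_hermsym.
    by apply/is_hermitianmxP; rewrite expr0 scale1r map_mx_id // /Ac map_trmx symA.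
  by apply/mxOverP => i j; rewrite mxE complex_real.
have realD := hermitian_spectral_diag_real herm.
have /orthomx_spectralP A_eq := hermitian_normalmx herm.
have uP := spectral_unitarymx Ac.
set P := spectralmx Ac in A_eq uP; set d := spectral_diag Ac in A_eq realD.
pose y := P *m map_mx f x.
have invP : invmx P = P^t* by exact: invmx_unitary.
have PP : P^t* *m P = 1%:M by rewrite -invP mulVmx // spectral_unit.
have PP' : P *m P^t* = 1%:M by rewrite -invP mulmxV // spectral_unit.
have AcE : Ac = P^t* *m diag_mx d *m P by rewrite -invP.
have key : f (4 * nsq x - nsq (A *m x)) = \sum_i (4 - d 0 i ^+ 2) * (y i 0 * (y i 0)^*%C).
  have AcT : Ac^T = Ac by rewrite /Ac map_trmx symA.
  have XT : (map_mx f x)^t* = (map_mx f x)^T.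
    by apply/matrixP => i j; rewrite !mxE; apply: conj_Creal; rewrite complex_real.
  have fnsq (z : 'cV[R]_n) : f (nsq z) = nsq (map_mx f z).
    by rewrite /nsq map_trmx -map_mxM [RHS]mxE.
  have yT : y^t* = (map_mx f x)^T *m P^t*.
    by rewrite /y trmx_mul map_mxM XT.
  have nX : nsq (map_mx f x) = (y^t* *m y) 0 0.
    by rewrite yT /y -mulmxA (mulmxA (P^t*)) PP mul1mx.
  have nAX : nsq (map_mx f (A *m x)) = (y^t* *m (diag_mx d *m diag_mx d) *m y) 0 0.
    have E : Ac *m Ac = P^t* *m (diag_mx d *m diag_mx d) *m P.
      by rewrite [in LHS]AcE !mulmxA -(mulmxA _ P) PP' mulmx1.
    rewrite /nsq map_mxM trmx_mul -/Ac AcT yT /y.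
    transitivity (((map_mx f x)^T *m (Ac *m Ac) *m map_mx f x) 0 0).
      by rewrite !mulmxA.
    by rewrite E !mulmxA.
  rewrite rmorphB rmorphM /= !fnsq nX nAX mulmx_diag.
  have -> : f 4 = 4 by rewrite /f rmorph_nat.
  rewrite -mulmxA mul_diag_mx !mxE mulr_sumr -sumrB.
  apply: eq_bigr => i _; rewrite !mxE; ring.
rewrite -subr_ge0 -ler0c -/f key sumr_ge0 // => i _.
apply: mulr_ge0; last exact: mul_conjC_ge0.
have /mxOverP/(_ 0 i)/complex_realP[r dr] := realD.
rewrite dr.
have rr : root (char_poly A) r.
  rewrite -(fmorph_root f) map_char_poly -/Ac -eigenvalue_root_char.
  apply/eigenvalueP; exists (row i P).
    have PA : P *m Ac = diag_mx d *m P by rewrite AcE !mulmxA PP' mul1mx.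
    by rewrite -row_mul PA; apply/rowP => j; rewrite mul_diag_mx !mxE dr.
  apply/eqP => row0; have /matrixP/(_ i i) := PP'.
  have : row i (P *m P^t*) = 0 by rewrite row_mul row0 mul0mx.
  by move=> /rowP/(_ i); rewrite [LHS]mxE => -> /eqP; rewrite !mxE eqxx eq_sym oner_eq0.
have /andP[h1 h2] := rootA _ rr.
have -> : 4 - r%:C ^+ 2 = (4 - r ^+ 2)%:C by rewrite rmorphB rmorphXn rmorph_nat.
by rewrite ler0c; nra.
Qed.
End Spectral.

(** * Galois conjugation *)

Lemma sqr_eq_5sqr (a b : int) : a ^+ 2 = 5 * b ^+ 2 -> b = 0.
Proof.
move=> /(congr1 absz); rewrite abszX abszM abszX => eq5.
case: (posnP `|b|) => [/eqP|b_gt0]; first by rewrite absz_eq0 => /eqP.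
have a_gt0 : (0 < `|a|)%N by case: `|a|%N eq5 => //; case: `|b|%N b_gt0.
have := congr1 (logn 5) eq5.
by rewrite lognM ?expn_gt0 ?b_gt0 // !lognX (_ : logn 5 `|5| = 1%N) //; lia.
Qed.

Section Golden.
Variable R : rcfType.
Local Notation phi := (phi R).
Local Notation phib := (phib R).

Lemma phibE : phib = 1 - phi.
Proof. by rewrite /phib /phi; field. Qed.

Lemma sqr_sqrt5 : Num.sqrt 5 ^+ 2 = 5 :> R.
Proof. by rewrite sqr_sqrtr ?ler0n. Qed.

Lemma phi_sqr : phi ^+ 2 = phi + 1.
Proof. by have := sqr_sqrt5; rewrite /phi => h; field: h. Qed.

Lemma phib_sqr : phib ^+ 2 = phib + 1.
Proof. by rewrite phibE; ring: phi_sqr. Qed.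

Lemma zphi_eq0 (a b : int) : a%:~R + b%:~R * phi = 0 -> a = 0 /\ b = 0.
Proof.
move=> e0; have b0 : b = 0.
  apply: (@sqr_eq_5sqr (2 * a + b)); apply/eqP; rewrite -(eqr_int R).
  rewrite rmorphXn rmorphM rmorphXn rmorphD rmorphM /=; apply/eqP.
  have -> : 2%:~R * a%:~R + b%:~R = - (b%:~R * Num.sqrt 5) :> R.
    move: e0; rewrite /phi => e0; lra.
  by rewrite sqrrN exprMn sqr_sqrt5 mulrC.
move: e0; rewrite b0 mul0r addr0 => /eqP; rewrite intr_eq0 => /eqP -> //.
Qed.

(** The Galois conjugate of [zmx phi A1 A2] is [zmx phib A1 A2]: conjugation becomes a change of the
    parameter [t]. *)
Definition zmx n (t : R) (A1 A2 : 'M[int]_n) : 'M[R]_n := imx R A1 + t *: imx R A2.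

Lemma over_Zphi_zmx n (A : 'M[R]_n) : over_Zphi A ->
  exists A1 A2, A = zmx phi A1 A2.
Proof.
move=> hA.
have /fin_all_exists[f fP] : forall ij : 'I_n * 'I_n, exists ab : int * int,
    A ij.1 ij.2 = ab.1%:~R + ab.2%:~R * phi.
  by move=> [i j]; have [a [b ->]] := hA i j; exists (a, b).
exists (\matrix_(i, j) (f (i, j)).1), (\matrix_(i, j) (f (i, j)).2).
by apply/matrixP => i j; rewrite !mxE (fP (i, j)) mulrC.
Qed.

Definition zeval (t : R) : {poly int} -> R := horner_eval t \o map_poly intr.
HB.instance Definition _ t := GRing.RMorphism.on (zeval t).

(* Reduce modulo the minimal polynomial of [phi]. *)
Lemma zeval_conj (q : {poly int}) : zeval phi q = 0 -> zeval phib q = 0.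
Proof.
pose m : {poly int} := 'X^2 - 'X - 1.
have sm : size m = 3%N.
  by rewrite /m -addrA -opprD size_polyDl ?size_polyXn // size_polyN -polyC1 size_XaddC.
have mm : m \is monic.
  by rewrite monicE lead_coefE sm /m !coefE.
have zm t : t ^+ 2 = t + 1 -> zeval t m = 0.
  move=> h; rewrite /m !rmorphB rmorphXn rmorph1 /= /zeval /= /horner_eval.
  by rewrite map_polyX hornerX h; ring.
have := Pdiv.RingMonic.rdivp_eq mm q; set r := Pdiv.Ring.rmodp q m; set h := Pdiv.Ring.rdivp q m => ->.
have sr : (size r <= 2)%N.
  rewrite -ltnS -sm /r Pdiv.Ring.ltn_rmodp.
  by rewrite -size_poly_gt0 sm.
rewrite !rmorphD !rmorphM /= !zm ?phi_sqr ?phib_sqr // !mulr0 !add0r.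
have rE : r = (r`_0)%:P + (r`_1)%:P * 'X.
  apply/polyP => -[|[|i]]; rewrite !(coefD, coefMX, coefC) /= ?addr0 ?add0r //.
  by rewrite nth_default // (leq_trans sr).
have er t : zeval t r = (r`_0)%:~R + (r`_1)%:~R * t.
  rewrite {1}rE rmorphD rmorphM /= /zeval /= /horner_eval !map_polyC map_polyX.
  by rewrite !hornerC hornerX.
by rewrite !er => /zphi_eq0[-> ->]; rewrite mul0r addr0.
Qed.

(** The coefficients are the values at [phi] of those of the characteristic polynomial of
    [A1 + X A2], which are polynomials over [int]. Where the value at [phi] is an integer,
    [zeval_conj] gives the same value at [phib]. *)
Lemma char_poly_conj n (A1 A2 : 'M[int]_n) (p : {poly int}) :
  char_poly (zmx phi A1 A2) = map_poly intr p ->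
  char_poly (zmx phib A1 A2) = map_poly intr p.
Proof.
pose M : 'M[{poly int}]_n := map_mx polyC A1 + 'X *: map_mx polyC A2.
have zE t : zmx t A1 A2 = map_mx (zeval t) M.
  apply/matrixP => i j; rewrite !mxE rmorphD rmorphM /= /zeval /= /horner_eval.
  by rewrite !map_polyC map_polyX !hornerC hornerX.
have cE t k : (char_poly (zmx t A1 A2))`_k = zeval t (char_poly M)`_k.
  by rewrite zE -map_char_poly coef_map.
move=> hp; apply/polyP => k; have /polyP/(_ k) := hp.
rewrite !cE !coef_map /= => hk.
have zC t c : zeval t c%:P = c%:~R by rewrite /zeval /= /horner_eval map_polyC hornerC.
apply/eqP; rewrite -(zC phib) -subr_eq0 -rmorphB; apply/eqP/zeval_conj.
by rewrite rmorphB /= zC hk subrr.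
Qed.

Lemma contraction2_conj n (A1 A2 : 'M[int]_n) : cyclotomic (zmx phi A1 A2) ->
  (contraction2 (zmx phi A1 A2) /\ contraction2 (zmx phib A1 A2)) /\ A1^T = A1 /\ A2^T = A2.
Proof.
move=> [symA [[p pE] rts]].
have sym12 : forall i j, A1 i j = A1 j i /\ A2 i j = A2 j i.
  move=> i j; have /matrixP/(_ i j) := symA; rewrite !mxE => e.
  have [] : A1 j i - A1 i j = 0 /\ A2 j i - A2 i j = 0.
    apply: zphi_eq0; rewrite !rmorphB /=. lra.
  by move=> /eqP; rewrite subr_eq0 => /eqP -> /eqP; rewrite subr_eq0 => /eqP ->.
have s1 : A1^T = A1 by apply/matrixP => i j; rewrite mxE; case: (sym12 i j).
have s2 : A2^T = A2 by apply/matrixP => i j; rewrite mxE; case: (sym12 i j).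
split=> //; split; first exact: contraction2_of_roots.
apply: contraction2_of_roots.
  by apply/matrixP => i j; rewrite !mxE; have [-> ->] := sym12 i j.
by move=> x; rewrite (char_poly_conj pE) -pE; apply: rts.
Qed.
End Golden.

(** * Matrices with square 4 *)

Section Square4.
Variable R : rcfType.

(* [det (xI - B) det (xI + B) = det ((x^2 - 4) I)]. *)
Lemma char_poly_sqr4 n (B : 'M[R]_n) : B *m B = 4%:M ->
  char_poly B %| ('X^2 - 4%:P) ^+ n.
Proof.
move=> B4.
have -> : ('X^2 - 4%:P) ^+ n = char_poly B * \det ('X%:M + map_mx polyC B).
  rewrite /char_poly -det_mulmx /char_poly_mx mulmxDr !mulmxBl.
  rewrite -map_mxM B4 map_scalar_mx /= addrA.
  have -> : 'X%:M *m map_mx polyC B = map_mx polyC B *m 'X%:M by rewrite scalar_mxC.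
  rewrite subrK -scalar_mxM.
  by rewrite -rmorphB det_scalar /= expr2.
exact: dvdp_mulIl.
Qed.

(** The characteristic polynomial divides a power of [(X - 2) (X + 2)], so it is a product of such
    linear factors and has integer coefficients. *)
Lemma cyclotomic_sqr4 n (B : 'M[R]_n) : B^T = B -> B *m B = 4%:M -> cyclotomic B.
Proof.
move=> symB B4; have dvd := char_poly_sqr4 B4; split=> //; split.
  pose rs : seq int := nseq n 2 ++ nseq n (- 2).
  have E : ('X^2 - 4%:P) ^+ n = \prod_(x <- map (fun z : int => z%:~R : R) rs) ('X - x%:P).
    rewrite big_map big_cat !big_nseq !iter_mulr_1 /= -exprMn; congr (_ ^+ n).
    have -> : (2 : int)%:~R = 2 :> R by [].
    have -> : (- 2 : int)%:~R = - 2 :> R by [].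
    by rewrite rmorphN rmorph_nat /= opprK -polyC_natr; ring.
  move: dvd; rewrite E => /dvdp_prod_XsubC[m]; rewrite -map_mask => em.
  exists (\prod_(x <- mask m rs) ('X - x%:P)).
  have -> : map_poly intr (\prod_(x <- mask m rs) ('X - x%:P)) =
    \prod_(x <- map (fun z : int => z%:~R : R) (mask m rs)) ('X - x%:P).
    rewrite rmorph_prod big_map; apply: eq_bigr => x _.
    by rewrite rmorphB /= map_polyX map_polyC.
  by apply/eqP; rewrite -eqp_monic ?char_poly_monic ?monic_prod_XsubC.
move=> x /rootP rx; have /rootP : root (('X^2 - 4%:P) ^+ n) x.
  by rewrite -dvdp_XsubCl (dvdp_trans _ dvd) // dvdp_XsubCl; apply/rootP.
rewrite !(hornerE, horner_exp) => /eqP; rewrite expf_eq0 => /andP[_ /eqP].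
by move=> x4; apply/andP; split; nra.
Qed.

Lemma row_norm_le4 n (A : 'M[R]_n) i : contraction2 A -> \sum_j A j i ^+ 2 <= 4.
Proof.
move=> /(_ (delta_mx i 0)); rewrite !nsqE.
have -> : \sum_j (delta_mx i 0 : 'cV[R]_n) j 0 ^+ 2 = 1.
  rewrite (bigD1 i) //= big1 ?mxE ?eqxx ?expr1n ?addr0 // => j /negPf ji.
  by rewrite mxE ji expr0n.
by rewrite mulr1 -colE; under eq_bigr do rewrite mxE.
Qed.

Lemma cyclotomic_contraction2 n (A : 'M[R]_n) : cyclotomic A -> contraction2 A.
Proof. by case=> symA [_ rts]; apply: contraction2_of_roots. Qed.

Lemma mx_adj_sym n (A : 'M[R]_n) : A^T = A -> symmetric (mx_adj A).
Proof. by move=> symA i j; rewrite /mx_adj eq_sym -{2}symA mxE. Qed.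

(* The rows of [B] already have the largest possible squared norm, 4, so no vertex of a
   cyclotomic supergraph outside [B] is adjacent to a vertex of [B]. *)
Lemma maximal_sqr4 n (B : 'M[R]_n) : over_Zphi B -> indecomposable B ->
  B^T = B -> B *m B = 4%:M -> maximal_indec_cyc_Zphi B.
Proof.
move=> ZB [n0 cB] symB B4; split.
  by split=> //; split=> //; apply: cyclotomic_sqr4.
move=> [m [C [[_ [[_ cC] cycC]] [nm [f [finj BE]]]]]].
have C2 := cyclotomic_contraction2 cycC; have [symC _] := cycC.
have Cout i u : u \notin codom f -> C u (f i) = 0.
  move=> uf; have := row_norm_le4 (f i) C2.
  rewrite (bigID (mem (codom f))) /=.
  have -> : \sum_(k in codom f) C k (f i) ^+ 2 = 4.
    rewrite -big_uniq /=; last by rewrite codomE map_inj_uniq ?enum_uniq.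
    rewrite codomE big_map big_enum /=.
    have /matrixP/(_ i i) := B4; rewrite !mxE eqxx mulr1n => <-.
    by apply: eq_bigr => k _; rewrite -[in B i k]symB BE !mxE expr2.
  rewrite gerDl (bigD1 u) //= => h.
  have : C u (f i) ^+ 2 <= 0.
    apply: le_trans h; rewrite lerDl sumr_ge0 // => k _; exact: sqr_ge0.
  by rewrite le_eqVlt ltNge sqr_ge0 orbF sqrf_eq0 => /eqP.
have [u uf] : exists u, u \notin codom f.
  apply/existsP; rewrite -negb_forall; apply/negP => /forallP h.
  have : (m <= n)%N; last by rewrite leqNgt nm.
  rewrite -(card_ord m) -(card_ord n) -(card_codom finj).
  by apply/subset_leq_card/subsetP => u _.
pose i0 := Ordinal n0.
have clo : closed (mx_adj C) (codom f).
  apply: intro_closed; first exact/sym_connect_sym/mx_adj_sym.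
  move=> x y /andP[_ Cxy] /codomP[i xE]; apply: contraNT Cxy => yf.
  by rewrite -symC mxE xE Cout.
have := closed_connect clo (cC (f i0) u).
by rewrite codom_f (negPf uf).
Qed.
End Square4.

(** * The finite computation *)

Local Delimit Scope Z_scope with Zb.

(* The pair [(a, b)] stands for [a + b * phi]. *)
Definition zp := (Z * Z)%type.
Definition zp0 : zp := (0, 0)%Zb.
Definition addp (x y : zp) : zp := (x.1 + y.1, x.2 + y.2)%Zb.
Definition oppp (x : zp) : zp := (- x.1, - x.2)%Zb.
Definition mulp (x y : zp) : zp :=
  (x.1 * y.1 + x.2 * y.2, x.1 * y.2 + x.2 * y.1 + x.2 * y.2)%Zb.
Definition conjp (x : zp) : zp := (x.1 + x.2, - x.2)%Zb.
Definition sqrp x := mulp x x.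
Definition zp_eqb (x y : zp) := Z.eqb x.1 y.1 && Z.eqb x.2 y.2.
Definition sgnp (b : bool) x := if b then oppp x else x.
(** [g] ranges over the group of order 4 generated by negation and Galois conjugation, the part of
    matrix equivalence that does not come from signed permutations. *)
Definition trp (g : bool * bool) x := sgnp g.1 (if g.2 then conjp x else x).

(* Positive trace or negative norm: [x] is positive in one of the two real embeddings. *)
Definition violp (x : zp) : bool :=
  Z.ltb 0 (2 * x.1 + x.2) || Z.ltb (x.1 * x.1 + x.1 * x.2 - x.2 * x.2) 0.
Definition excess4 x := violp (addp x (-4, 0)%Zb).

Definition zmat := seq (seq zp).
Definition zget (M : zmat) i j := nth zp0 (nth [::] M i) j.

Fixpoint dotp (u v : seq zp) : zp :=
  match u, v with
  | x :: u', y :: v' => addp (mulp x y) (dotp u' v')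
  | _, _ => zp0
  end.
Definition normp v := dotp v v.
Definition mulmv (M : zmat) (v : seq zp) := map (dotp^~ v) M.

(* Power iteration: for a symmetric [M] the ratios [|M^(k+1) x| / |M^k x|] increase with [k]. *)
Fixpoint refute fuel (M : zmat) x nx :=
  if fuel is fuel'.+1 then
    let y := mulmv M x in let ny := normp y in
    if violp (addp ny (mulp (-4, 0)%Zb nx)) then true else refute fuel' M y ny
  else false.

Definition extend (M : zmat) (v : seq zp) (c : zp) : zmat :=
  rcons [seq rcons rx.1 rx.2 | rx <- zip M v] (rcons v c).

(** Start of the power iteration: the old matrix already satisfies the norm bound, so every
    violation involves the new vertex, whose basis vector this is. *)
Definition last_unit k : seq zp := rcons (nseq k zp0) (1, 0)%Zb.

Definition all_perm_sgn (M N : zmat) (g : bool * bool) (p : seq nat) (s : seq bool) : bool :=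
  let k := size M in
  perm_eq p (iota 0 k) &&
  all (fun i => all (fun j =>
    zp_eqb (zget M i j)
        (sgnp (nth false s i) (sgnp (nth false s j) (trp g (zget N (nth 0 p i) (nth 0 p j))))))
    (iota 0 k)) (iota 0 k).

Definition map_zmat (f : zp -> zp) (M : zmat) : zmat := map (map f) M.

Definition consistent (M N : zmat) (p : seq nat) (s : seq bool) v b :=
  let i := size p in
  zp_eqb (zget M i i) (zget N v v) &&
  all (fun j => zp_eqb (zget M i j) (sgnp b (sgnp (nth false s j) (zget N v (nth 0 p j)))))
      (iota 0 i).

Definition candidates k : seq (nat * bool) :=
  flatten [seq [:: (v, false); (v, true)] | v <- iota 0 k].

Fixpoint firsts (A B : Type) (f : A -> option B) (l : seq A) : option B :=
  if l is x :: l' then (if f x is Some y then Some y else firsts f l') else None.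

(** Backtracking over the images and the signs of the vertices of [M]. Nothing is proved about it:
    [equivb] tests its answer with [all_perm_sgn]. *)
Fixpoint search fuel (M N : zmat) (p : seq nat) (s : seq bool) : option (seq nat * seq bool) :=
  if fuel is fuel'.+1 then
    firsts (fun vb =>
      if vb.1 \in p then None else if ~~ consistent M N p s vb.1 vb.2 then None
      else search fuel' M N (rcons p vb.1) (rcons s vb.2)) (candidates (size M))
  else Some (p, s).

Definition zentries (M : zmat) := flatten M.
(* Cheap invariants, to avoid most calls to [search]. *)
Definition profile (M : zmat) : seq nat :=
  let unit x := zp_eqb (sqrp x) (1, 0)%Zb in
  let diag := [seq zget M i i | i <- iota 0 (size M)] in
  [:: count unit (zentries M); count (zp_eqb zp0) (zentries M);
      count unit diag; count (zp_eqb zp0) diag].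

Definition equivb (M N : zmat) : bool :=
  if profile M != profile N then false
  else has (fun g => if search (size M) M (map_zmat (trp g) N) [::] [::] is Some ps
                then all_perm_sgn M N g ps.1 ps.2 else false)
      [:: (false, false); (true, false); (false, true); (true, true)].

(** These are 0, 1, 2, [phi], [phib] and their negatives, the elements of absolute value at most 2
    in both embeddings; every matrix entry is one of them. *)
Definition alphabet : seq zp :=
  [seq x <- [seq (p, q) | p <- [:: -2; -1; 0; 1; 2]%Zb, q <- [:: -1; 0; 1]%Zb]
   | ~~ excess4 (sqrp x)].

Section Check.
Variable reps : seq zmat.

(* Conditionals instead of [||]: [vm_compute] would evaluate both arguments of [||]. *)
Definition leaf M v c : bool :=
  let B := extend M v c in
  if refute 10 B (last_unit (size M)) (1, 0)%Zb then true
  else has (fun M' => if size M' == size B then equivb M' B else false) reps.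

(** Enumerates the columns of a new vertex entry by entry. [rem] holds the squared norms of the rows
    of [M] still to be extended and [t] the squared norm of the partial column [acc]; a branch is
    dropped once a row norm exceeds 4 in one embedding. The zero column is skipped because it gives
    a disconnected matrix. *)
Fixpoint check_ext M (rem : seq zp) (acc : seq zp) (t : zp) : bool :=
  if rem is r :: rem' then
    all (fun a => let aa := sqrp a in
           if excess4 (addp t aa) then true else if excess4 (addp r aa) then true
           else check_ext M rem' (rcons acc a) (addp t aa)) alphabet
  else if all (zp_eqb zp0) acc then true
    else all (fun c => if excess4 (addp t (sqrp c)) then true else leaf M acc c) alphabet.

Definition check_rep M := check_ext M (map normp M) [::] zp0.
End Check.

Definition wgraphp (k : nat) (ch : seq zp) (es : seq (nat * nat * zp)) : zmat :=
  [seq [seq if i == j then nth zp0 ch i else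
    foldr (fun e t => if ((e.1.1 == i) && (e.1.2 == j)) || ((e.1.1 == j) && (e.1.2 == i))
                      then addp e.2 t else t) zp0 es
   | j <- iota 0 k] | i <- iota 0 k].

Section Graphs.
Local Open Scope Z_scope.
Let F : zp := (0, 1). Let G : zp := (1, -1). Let E : zp := (1, 0).
Let F' : zp := (0, -1). Let G' : zp := (-1, 1). Let E' : zp := (-1, 0).
Definition graph_data : seq (nat * seq zp * seq (nat * nat * zp)) :=
 [:: (3, [:: F; G; E], [:: (0, 2, G); (2, 1, F); (0, 1, E)]);
     (4, [:: E; E'; E'; E], [:: (0, 1, F); (0, 2, G); (1, 3, G); (2, 3, F')]);
     (4, [:: F; F'; F'; F], [:: (0, 2, G); (1, 3, G); (0, 1, E); (2, 3, E')]);
     (4, [:: zp0; F; G; E'], [:: (0, 1, G); (0, 2, F); (1, 3, E); (2, 3, E); (0, 3, E)]);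
     (6, [::], [:: (0, 1, F); (2, 3, F); (4, 5, F); (1, 4, G); (0, 3, G); (2, 5, G);
                   (1, 2, E); (3, 4, E); (0, 5, E)]);
     (8, [::], [:: (0, 1, G); (4, 5, G); (6, 7, G); (2, 3, G'); (2, 6, F); (0, 4, F);
                   (3, 7, F); (1, 5, F'); (1, 3, E); (5, 7, E); (0, 2, E); (4, 6, E')]);
     (8, [::], [:: (0, 1, F); (2, 6, F); (5, 7, F); (1, 5, G); (6, 7, G); (0, 2, G);
                   (4, 5, E); (2, 3, E); (1, 3, E); (4, 6, E); (0, 4, E); (3, 7, E);
                   (3, 4, E')])]%N.
End Graphs.

Definition graphs : seq zmat := [seq wgraphp d.1.1 d.1.2 d.2 | d <- graph_data].

(* One pair (graph, vertices) for every equivalence class of connected induced subgraphs with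
   an irrational weight or charge, found by an unverified search; [check_all] shows that the list
   is complete. *)
Definition subgraphs : seq (nat * seq nat) := 
     [:: (0, [:: 0]); (3, [:: 1; 3]); (2, [:: 0; 1]); (0, [:: 0; 1]); (3, [:: 1; 0]);
      (0, [:: 0; 2]); (2, [:: 0; 2]); (4, [:: 0; 1]); (1, [:: 0; 1]); (3, [:: 1; 3; 2]);
      (3, [:: 1; 3; 0]); (2, [:: 0; 1; 3]); (0, [:: 0; 1; 2]); (3, [:: 1; 0; 2]); (4,
      [:: 0; 1; 2]); (4, [:: 0; 1; 4]); (1, [:: 0; 1; 3]); (3, [:: 1; 3; 2; 0]); (2, [::
      0; 1; 3; 2]); (6, [:: 0; 1; 3; 7]); (5, [:: 0; 4; 6; 7]); (4, [:: 0; 1; 2; 4]);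
      (6, [:: 0; 1; 3; 4]); (5, [:: 0; 4; 6; 2]); (4, [:: 0; 1; 2; 5]); (5, [:: 0; 4; 6;
      1]); (6, [:: 0; 1; 3; 2]); (4, [:: 0; 1; 2; 3]); (6, [:: 0; 1; 5; 7]); (5, [:: 0;
      4; 5; 1]); (1, [:: 0; 1; 3; 2]); (6, [:: 0; 1; 3; 7; 6]); (6, [:: 0; 1; 3; 7; 5]);
      (6, [:: 0; 1; 3; 7; 4]); (6, [:: 0; 1; 3; 7; 2]); (5, [:: 0; 4; 6; 7; 3]); (5, [::
      0; 4; 6; 7; 5]); (6, [:: 0; 1; 3; 5; 4]); (4, [:: 0; 1; 2; 4; 5]); (5, [:: 0; 4;
      6; 5; 1]); (5, [:: 0; 4; 6; 1; 3]); (6, [:: 0; 1; 5; 7; 6]); (6, [:: 0; 1; 3; 7;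
      6; 5]); (6, [:: 0; 1; 3; 7; 6; 4]); (6, [:: 0; 1; 3; 7; 6; 2]); (6, [:: 0; 1; 3;
      7; 5; 4]); (6, [:: 0; 1; 3; 7; 4; 2]); (5, [:: 0; 4; 6; 7; 3; 5]); (5, [:: 0; 4;
      6; 7; 3; 2]); (5, [:: 0; 4; 6; 7; 3; 1]); (5, [:: 0; 4; 6; 7; 5; 2]); (4, [:: 0;
      1; 2; 4; 5; 3]); (5, [:: 0; 4; 6; 5; 1; 3]); (6, [:: 0; 1; 5; 7; 6; 2]); (6, [::
      0; 1; 3; 7; 6; 5; 4]); (6, [:: 0; 1; 3; 7; 6; 5; 2]); (5, [:: 0; 4; 6; 7; 3; 5;
      2]); (6, [:: 0; 1; 3; 7; 6; 5; 4; 2]); (5, [:: 0; 4; 6; 7; 3; 5; 2; 1])].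

Definition zsub (M : zmat) (idx : seq nat) : zmat :=
  [seq [seq zget M i j | j <- idx] | i <- idx].

Definition reps : seq zmat := [seq zsub (nth [::] graphs ki.1) ki.2 | ki <- subgraphs].

Definition irrational (x : zp) := ~~ Z.eqb x.2 0.

(** The list is closed under adding a vertex, and contains the two kinds of seeds: an irrational
    charge, and an irrational edge with arbitrary charges at its ends, unless the norm bound
    excludes it. *)
Definition check_all : bool :=
  [&& all (check_rep reps) reps,
      all (fun x => if irrational x then 
        has (fun M => if size M == 1 then equivb M [:: [:: x]] else false) reps else true) alphabet &
      all (fun x => if irrational x then all (fun a => all (fun d => leaf reps [:: [:: a]] [:: x] d)
        alphabet) alphabet else true) alphabet].

(** * Soundness of the computation *)

Section Eval.
Variable R : rcfType.
Implicit Types (x y : zp) (t : R).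

Definition zr (z : Z) : R := (int_of_Z z)%:~R.
Definition ev t x : R := zr x.1 + zr x.2 * t.
(** The solutions are [phi] and [phib], so a bound for all golden [t] is a bound in both
    embeddings. *)
Definition golden t := t ^+ 2 = t + 1.

Lemma zrD a b : zr (Z.add a b) = zr a + zr b.
Proof. by rewrite /zr -rmorphD; congr (_ %:~R); lia. Qed.
Lemma zrM a b : zr (Z.mul a b) = zr a * zr b.
Proof. by rewrite /zr -rmorphM; congr (_ %:~R); lia. Qed.
Lemma zrN a : zr (Z.opp a) = - zr a.
Proof. by rewrite /zr -rmorphN; congr (_ %:~R); lia. Qed.

Lemma evD t x y : ev t (addp x y) = ev t x + ev t y.
Proof. by rewrite /ev /= !zrD; ring. Qed.
Lemma evN t x : ev t (oppp x) = - ev t x.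
Proof. by rewrite /ev /= !zrN; ring. Qed.
Lemma evM t x y : golden t -> ev t (mulp x y) = ev t x * ev t y.
Proof. by move=> h; rewrite /ev /= !zrD !zrM; ring: h. Qed.
Lemma ev0 t : ev t zp0 = 0.
Proof. by rewrite /ev /zr /= mul0r addr0. Qed.
Lemma ev_conj t x : ev t (conjp x) = ev (1 - t) x.
Proof. by rewrite /ev /= zrD zrN; ring. Qed.
Lemma golden_conj t : golden t -> golden (1 - t).
Proof. by rewrite /golden => h; ring: h. Qed.
Lemma ev_sgn t b x : ev t (sgnp b x) = (-1) ^+ b * ev t x.
Proof. by case: b; rewrite /= ?evN ?mul1r ?mulN1r. Qed.
Lemma evN4 t : ev t (Zneg 4, Z0) = - 4.
Proof. by rewrite /ev /zr /= mul0r addr0. Qed.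
Lemma golden_phi : golden (phi R). Proof. exact: phi_sqr. Qed.

Lemma zp_eqbP x y : reflect (x = y) (zp_eqb x y).
Proof.
case: x y => [a b] [c d]; rewrite /zp_eqb /=.
by apply: (iffP andP) => [[/Z.eqb_eq -> /Z.eqb_eq ->]|[-> ->]]; rewrite ?Z.eqb_refl.
Qed.

Lemma zr_gt0 z : Z.ltb 0 z -> 0 < zr z.
Proof. by rewrite /zr ltr0z => h; lia. Qed.

Lemma violp_sound x : violp x -> (forall t, golden t -> ev t x <= 0) -> False.
Proof.
move=> vx h; have h1 := h _ golden_phi; have h2 := h _ (golden_conj golden_phi).
have gp := golden_phi; move: vx h1 h2; rewrite /violp /ev.
set a := zr x.1; set b := zr x.2 => /orP[/zr_gt0|/Z.ltb_lt lt0].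
  by rewrite zrD zrM (_ : zr 2 = 2) // -/a -/b => *; nra.
have : 0 < zr (- (x.1 * x.1 + x.1 * x.2 - x.2 * x.2)) by apply: zr_gt0; lia.
rewrite zrN !(zrD, zrM, zrN) -/a -/b => pos h1 h2.
have := mulr_le0 h1 h2; rewrite /golden in gp.
have -> : (a + b * phi R) * (a + b * (1 - phi R)) = a * a + a * b - b * b by ring: gp.
by move=> *; lra.
Qed.

Lemma excess4_sound x : excess4 x -> (forall t, golden t -> ev t x <= 4) -> False.
Proof.
move=> /violp_sound vx h; apply: vx => t gt.
by rewrite evD evN4; have := h t gt; lra.
Qed.

Lemma ev_dotp t (u v : seq zp) : golden t -> size u = size v ->
  ev t (dotp u v) = \sum_(i < size u) ev t (nth zp0 u i) * ev t (nth zp0 v i).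
Proof.
move=> gt; elim: u v => [|x u IH] [|y v] //=; first by rewrite big_ord0 ev0.
by move=> [/IH e]; rewrite big_ord_recl evD evM // e.
Qed.

Lemma ev_normp t (u : seq zp) : golden t ->
  ev t (normp u) = \sum_(i < size u) ev t (nth zp0 u i) ^+ 2.
Proof. by move=> gt; rewrite /normp ev_dotp //; apply: eq_bigr => i _; rewrite expr2. Qed.

Lemma ev_normp_ge0 t (u : seq zp) : golden t -> 0 <= ev t (normp u).
Proof. by move=> gt; rewrite ev_normp // sumr_ge0 // => i _; apply: sqr_ge0. Qed.

Definition square (M : zmat) := all (fun r => size r == size M) M.

(** Stated for vectors over [Z[phi]], the ones that [refute] meets. *)
Definition contracting (M : zmat) := forall t, golden t -> forall x : seq zp, size x = size M ->
  ev t (normp (mulmv M x)) <= 4 * ev t (normp x).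

Lemma refute_sound fuel M (x : seq zp) : contracting M -> size x = size M ->
  ~~ refute fuel M x (normp x).
Proof.
move=> cM; elim: fuel x => //= fuel IH x sx.
case: ifP => [/violp_sound v|_]; last by apply: IH; rewrite size_map.
exfalso; apply: v => t gt; rewrite evD evM // evN4.
by have := cM t gt x sx; lra.
Qed.
End Eval.

Lemma sgnp_inj b : injective (sgnp b).
Proof. by case: b => // -[a b] [c d]; rewrite /sgnp /oppp /= => -[h1 h2]; congr (_, _); lia. Qed.

Lemma sgnpK b : involutive (sgnp b).
Proof. by case: b => // -[a b]; rewrite /sgnp /oppp /=; congr (_, _); lia. Qed.

Lemma sgnpA a b x : sgnp a (sgnp b x) = sgnp (a (+) b) x.
Proof.
by case: a; case: b => //; rewrite /sgnp; case: x => x y; rewrite /oppp /=; congr (_, _); lia.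
Qed.

Lemma trp_sgnp g b x : trp g (sgnp b x) = sgnp b (trp g x).
Proof.
case: b => //; case: g => -[] []; case: x => x y; rewrite /trp /oppp /conjp /=;
  congr (_, _); rewrite /=; lia.
Qed.

Lemma trp_trp g h x : trp g (trp h x) = trp (g.1 (+) h.1, g.2 (+) h.2) x.
Proof.
case: g h x => -[] [] [[] []] [x y]; rewrite /trp /sgnp /oppp /conjp /=;
  congr (_, _); rewrite /=; lia.
Qed.

Lemma trpK g : involutive (trp g).
Proof. by move=> x; rewrite trp_trp !addbb /trp. Qed.

Section Match.
Variables (R : rcfType) (n : nat) (e : 'I_n -> 'I_n -> zp) (u0 : 'I_n).

Definition emx t : 'M[R]_n := \matrix_(i, j) ev t (e i j).
Hypothesis weak_e : forall t : R, golden t -> contraction2 (emx t).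
Hypothesis sym_e : forall i j, e i j = e j i.

(* Up to the sign changes [sg], the Galois conjugation and negation [g], the submatrix of [e]
   on the vertices [vs] is [M]. *)
Definition matches (g : bool * bool) (sg : 'I_n -> bool) (vs : seq 'I_n) (M : zmat) :=
  [/\ uniq vs, size vs = size M, square M &
   forall i j, (i < size M)%N -> (j < size M)%N ->
     trp g (e (nth u0 vs i) (nth u0 vs j)) =
     sgnp (sg (nth u0 vs i)) (sgnp (sg (nth u0 vs j)) (zget M i j))].

Lemma ev_trp t g x : ev t (trp g x) = (-1) ^+ g.1 * ev (if g.2 then 1 - t else t) x :> R.
Proof. by rewrite /trp ev_sgn; case: g.2; rewrite ?ev_conj. Qed.

Lemma sum_mem (vs : seq 'I_n) (F : 'I_n -> R) : uniq vs ->
  \sum_(u in vs) F u = \sum_(i < size vs) F (nth u0 vs i).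
Proof. by move=> us; rewrite -big_uniq // (big_nth u0) big_mkord. Qed.

(** A vector for [M] is multiplied by the signs and extended by 0 outside [vs]; the coordinates of
    its image outside [vs] can only enlarge the norm. If [g] conjugates, the bound for [e] is used
    in the other embedding, [1 - t]. *)
Lemma matches_contracting g sg vs M : matches g sg vs M -> contracting R M.
Proof.
move=> [us sz sqM hM] t gt x sx.
pose t' := if g.2 then 1 - t else t.
have gt' : golden t' by rewrite /t'; case: g.2 => //; apply: golden_conj.
pose s u : R := (-1) ^+ sg u.
have ss u : s u * s u = 1 by rewrite /s -expr2 sqrr_sign.
pose X : 'cV[R]_n := \col_u (if u \in vs then s u * ev t (nth zp0 x (index u vs)) else 0).
have Xi i : (i < size vs)%N -> X (nth u0 vs i) 0 = s (nth u0 vs i) * ev t (nth zp0 x i).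
  by move=> ii; rewrite mxE mem_nth // index_uniq.
have nX : nsq X = ev t (normp x).
  rewrite nsqE ev_normp // (bigID (mem vs)) /= [X in _ + X]big1 ?addr0; last first.
    by move=> u /negPf h; rewrite mxE h expr0n.
  rewrite sum_mem // sz sx; apply: eq_bigr => -[i ii] _ /=.
  by rewrite Xi ?sz // exprMn sqrr_sign mul1r.
have AX i : (i < size vs)%N ->
   (emx t' *m X) (nth u0 vs i) 0 ^+ 2 = ev t (nth zp0 (mulmv M x) i) ^+ 2.
  move=> ii; rewrite (nth_map [::]) -?sz // ev_dotp //; last first.
    by apply/eqP; rewrite sx; apply: (allP sqM); rewrite mem_nth // -sz.
  have /eqP -> : size (nth [::] M i) == size M by apply: (allP sqM); rewrite mem_nth // -sz.
  rewrite mxE (bigID (mem vs)) /= [X in _ + X]big1 ?addr0; last first.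
    by move=> u /negPf h; rewrite [X u 0]mxE h mulr0.
  rewrite sum_mem //.
  transitivity (((-1) ^+ g.1 * s (nth u0 vs i) *
    \sum_(j < size M) ev t (zget M i j) * ev t (nth zp0 x j)) ^+ 2); last first.
    by rewrite exprMn exprMn !sqrr_sign !mul1r.
  congr (_ ^+ 2); rewrite mulr_sumr sz; apply: eq_bigr => -[j jj] _ /=.
  have := congr1 (ev t) (hM i j _ jj); rewrite -{1}sz ii => /(_ isT).
  rewrite ev_trp !ev_sgn -/t' -!/(s _) => E.
  rewrite mxE Xi ?sz //.
  have gg : (-1) ^+ g.1 * (-1) ^+ g.1 = 1 :> R by rewrite -expr2 sqrr_sign.
  have -> : ev t' (e (nth u0 vs i) (nth u0 vs j)) = (-1) ^+ g.1 *
    (s (nth u0 vs i) * (s (nth u0 vs j) * ev t (zget M i j))).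
    by rewrite -E mulrA gg mul1r.
  have := ss (nth u0 vs j); set sj := s (nth u0 vs j) => sj1.
  by ring: sj1.
rewrite -nX; apply: le_trans (weak_e gt' X).
rewrite nsqE ev_normp // size_map -sz (bigID (mem vs)) /= sum_mem //.
rewrite [X in _ <= X + _](eq_bigr (fun i : 'I_(size vs) => ev t (nth zp0 (mulmv M x) i) ^+ 2)).
  by rewrite lerDl sumr_ge0 // => i _; apply: sqr_ge0.
by move=> -[i ii] _ /=; rewrite AX.
Qed.
End Match.

Section Extend.
Variables (M : zmat) (v : seq zp) (c : zp).
Hypotheses (sqM : square M) (sv : size v = size M).

Lemma size_extend : size (extend M v c) = (size M).+1.
Proof. by rewrite /extend size_rcons size_map size_zip sv minnn. Qed.

Lemma nth_extend i : (i < size M)%N ->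
  nth [::] (extend M v c) i = rcons (nth [::] M i) (nth zp0 v i).
Proof.
move=> ii; rewrite /extend nth_rcons size_map size_zip sv minnn ii.
by rewrite (nth_map ([::], zp0)) ?size_zip ?sv ?minnn // nth_zip.
Qed.

Lemma nth_extend_last : nth [::] (extend M v c) (size M) = rcons v c.
Proof. by rewrite /extend nth_rcons size_map size_zip sv minnn ltnn eqxx. Qed.

Lemma square_extend : square (extend M v c).
Proof.
apply/(all_nthP [::]) => i; rewrite size_extend ltnS leq_eqVlt => /orP[/eqP->|ii].
  by rewrite nth_extend_last size_rcons sv.
by rewrite nth_extend // size_rcons; move/(all_nthP [::]): sqM => /(_ i ii) /eqP ->.
Qed.

Lemma zget_extend i j : (i < size M)%N -> (j < size M)%N ->
  zget (extend M v c) i j = zget M i j.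
Proof.
move=> ii jj; rewrite /zget nth_extend // nth_rcons.
by move/(all_nthP [::]): sqM => /(_ i ii) /eqP ->; rewrite jj.
Qed.

Lemma zget_extend_col i : (i < size M)%N -> zget (extend M v c) i (size M) = nth zp0 v i.
Proof.
move=> ii; rewrite /zget nth_extend // nth_rcons.
by move/(all_nthP [::]): sqM => /(_ i ii) /eqP ->; rewrite ltnn eqxx.
Qed.

Lemma zget_extend_row j : (j < size M)%N -> zget (extend M v c) (size M) j = nth zp0 v j.
Proof. by move=> jj; rewrite /zget nth_extend_last nth_rcons sv jj. Qed.

Lemma zget_extend_diag : zget (extend M v c) (size M) (size M) = c.
Proof. by rewrite /zget nth_extend_last nth_rcons sv ltnn eqxx. Qed.
End Extend.

Section CheckSound.
Variable R : rcfType.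

Lemma ev_normp_rcons (t : R) u a : golden t ->
  ev t (normp (rcons u a)) = ev t (normp u) + ev t a ^+ 2.
Proof.
move=> gt; rewrite !ev_normp // size_rcons big_ord_recr /= nth_rcons ltnn eqxx.
by congr (_ + _); apply: eq_bigr => -[i ii] _ /=; rewrite nth_rcons ii.
Qed.

Lemma contracting_row (t : R) B i : golden t -> contracting R B -> square B ->
  (forall i j, (i < size B)%N -> (j < size B)%N -> zget B i j = zget B j i) ->
  (i < size B)%N -> ev t (normp (nth [::] B i)) <= 4.
Proof.
move=> gt cB sqB symB ii.
pose x := mkseq (fun j => if j == i then (Zpos 1, Z0) else zp0) (size B).
have sx : size x = size B by rewrite size_mkseq.
have evx j : (j < size B)%N -> ev t (nth zp0 x j) = (j == i)%:R.
  by move=> jj; rewrite nth_mkseq //; case: eqP => _; rewrite ?ev0 // /ev /zr /= mul0r addr0.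
have szi j : (j < size B)%N -> size (nth [::] B j) = size B.
  by move=> jj; apply/eqP; apply: (allP sqB); rewrite mem_nth.
have := cB t gt x sx; rewrite !ev_normp // size_map szi // sx.
have -> : \sum_(j < size B) ev t (nth zp0 x j) ^+ 2 = 1.
  rewrite (bigD1 (Ordinal ii)) //= evx // eqxx expr1n big1 ?addr0 // => -[j jj] /= ne.
  by rewrite evx // (_ : (j == i) = false) ?expr0n //; apply: contraNF ne => /eqP e; apply/eqP/val_inj.
rewrite mulr1; congr (_ <= _); apply: eq_bigr => -[j jj] _ /=; congr (_ ^+ 2).
rewrite (nth_map [::]) // ev_dotp ?szi // (bigD1 (Ordinal ii)) //= evx // eqxx mulr1.
rewrite big1 ?addr0 => [|[k kk] /= ne].
  by congr (ev _ _); rewrite -/(zget B j i) symB.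
by rewrite evx // (_ : (k == i) = false) ?mulr0 //; apply: contraNF ne => /eqP e; apply/eqP/val_inj.
Qed.

Lemma sqrD_le16 (x y : R) : x ^+ 2 <= 4 -> y ^+ 2 <= 4 -> (x + y) ^+ 2 <= 16.
Proof. by move=> hx hy; have := sqr_ge0 (x - y); nra. Qed.

(** The sum [2 a + b] and the difference [b sqrt 5] of the two conjugates of [a + b phi] are at most
    4 in absolute value, which leaves finitely many pairs. *)
Lemma mem_alphabet (x : zp) : (forall t : R, golden t -> ev t x ^+ 2 <= 4) -> x \in alphabet.
Proof.
move=> hx; rewrite mem_filter; apply/andP; split.
  apply/negP => /excess4_sound h; apply: (h R) => t gt.
  by rewrite /sqrp evM // -expr2 hx.
case: x hx => a b hx.
have h1 := hx _ (golden_phi R); have h2 := hx _ (golden_conj (golden_phi R)).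
have gp := golden_phi R; move: h1 h2; rewrite /ev /= => h1 h2.
have h3 : zr R (2 * a + b) ^+ 2 <= 16.
  rewrite zrD zrM (_ : zr R 2 = 2) //.
  have -> : 2 * zr R a + zr R b = (zr R a + zr R b * phi R) + (zr R a + zr R b * (1 - phi R)).
    by ring.
  by apply: sqrD_le16.
have h4 : 5 * zr R b ^+ 2 <= 16.
  have -> : 5 * zr R b ^+ 2 = ((zr R a + zr R b * phi R) + - (zr R a + zr R b * (1 - phi R))) ^+ 2.
    by rewrite /golden in gp; ring: gp.
  by apply: sqrD_le16; rewrite // sqrrN.
have h5 : (int_of_Z (2 * a + b) ^+ 2 <= 16).
  by rewrite -(ler_int R) rmorphXn /= (_ : 16%:~R = 16) //.
have h6 : (5 * int_of_Z b ^+ 2 <= 16).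
  by rewrite -(ler_int R) rmorphM rmorphXn /= (_ : 16%:~R = 16).
have b1 : (Z.le (-1) b /\ Z.le b 1) by split; nia.
have a1 : (Z.le (-2) a /\ Z.le a 2) by split; nia.
have : b = Zneg 1 \/ b = Z0 \/ b = Zpos 1 by lia.
have : a = Zneg 2 \/ a = Zneg 1 \/ a = Z0 \/ a = Zpos 1 \/ a = Zpos 2 by lia.
by move=> [|[|[|[|]]]] -> [|[|]] ->.
Qed.

Variable rs : seq zmat.

Lemma check_ext_sound M rem acc tt v c :
  check_ext rs M rem acc tt -> size v = size rem ->
  (forall t : R, golden t -> ev t tt + \sum_(x <- v) ev t x ^+ 2 + ev t c ^+ 2 <= 4) ->
  (forall i, (i < size rem)%N -> forall t : R, golden t ->
     ev t (nth zp0 rem i) + ev t (nth zp0 v i) ^+ 2 <= 4) ->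
  {subset v <= alphabet} -> c \in alphabet ->
  ~~ all (zp_eqb zp0) (acc ++ v) ->
  leaf rs M (acc ++ v) c.
Proof.
have E0 acc' t' : check_ext rs M [::] acc' t' = if all (zp_eqb zp0) acc' then true
    else all (fun c => if excess4 (addp t' (sqrp c)) then true else leaf rs M acc' c) alphabet by [].
have E1 r' rem' acc' t' : check_ext rs M (r' :: rem') acc' t' =
    all (fun a => if excess4 (addp t' (sqrp a)) then true else if excess4 (addp r' (sqrp a))
      then true else check_ext rs M rem' (rcons acc' a) (addp t' (sqrp a))) alphabet by [].
elim: rem acc tt v => [|r rem IH] acc tt [|a v] //; rewrite ?E0 ?E1.
  rewrite cats0 => + _ hs _ _ hc /negPf nz; rewrite nz => h0; have := allP h0 c hc.
  case: ifP => // /excess4_sound h; exfalso; apply: (h R) => t gt.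
  by rewrite evD /sqrp evM // -expr2; have := hs t gt; rewrite big_nil addr0.
move=> h0 [sv] hs /= hr hv hc nz.
have ha (t : R) : golden t -> ev t r + ev t a ^+ 2 <= 4 by move=> gt; apply: (hr 0%N).
have am : a \in alphabet by apply: hv; rewrite mem_head.
have := allP h0 a am; case: ifP => [/excess4_sound h|_].
  exfalso; apply: (h R) => t gt; rewrite evD /sqrp evM // -expr2.
  have := hs t gt; rewrite big_cons; have : 0 <= \sum_(x <- v) ev t x ^+ 2.
    by rewrite sumr_ge0 // => i _; apply: sqr_ge0.
  by have := sqr_ge0 (ev t c); lra.
case: ifP => [/excess4_sound h|_ h].
  by exfalso; apply: (h R) => t gt; rewrite evD /sqrp evM // -expr2 ha.
rewrite -cat_rcons; apply: (IH (rcons acc a) (addp tt (sqrp a))) => //.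
- by move=> t gt; have := hs t gt; rewrite evD /sqrp evM // big_cons; lra.
- by move=> i ii; apply: (hr i.+1).
- by move=> x xv; apply: hv; rewrite in_cons xv orbT.
by rewrite cat_rcons.
Qed.
End CheckSound.

Lemma check_all_true : check_all.
Proof. by vm_cast_no_check (erefl true). Qed.

Lemma square_reps : all square reps.
Proof. by vm_cast_no_check (erefl true). Qed.

Lemma check_reps M : M \in reps -> check_rep reps M.
Proof. by move=> Mr; case/and3P: check_all_true => /allP/(_ M Mr). Qed.

Lemma sgnp0 b : sgnp b zp0 = zp0.
Proof. by case: b. Qed.

Lemma trp0 g : trp g zp0 = zp0.
Proof. by case: g => -[] []. Qed.

Lemma equivb_sound M N : equivb M N -> exists g p s, all_perm_sgn M N g p s.
Proof.
rewrite /equivb; case: ifP => // _ /hasP[g _].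
by case: search => // -[p s] h; exists g, p, s.
Qed.

Lemma connect_exit (T : finType) (r : rel T) (A : pred T) x y :
  connect r x y -> x \in A -> y \notin A -> exists a b, [/\ a \in A, b \notin A & r a b].
Proof.
move=> /connectP[p]; elim: p x => [|z p IH] x /=; first by move=> _ -> ->.
move=> /andP[rxz pz] yE xA yA; case: (boolP (z \in A)) => zA; first exact: IH pz yE zA yA.
by exists x, z.
Qed.

(** * Growing an irrational submatrix *)

Section Growth.
Variables (R : rcfType) (n : nat) (e : 'I_n -> 'I_n -> zp) (u0 : 'I_n).
Hypothesis weak_e : forall t : R, golden t -> contraction2 (emx e t).
Hypothesis sym_e : forall i j, e i j = e j i.
Local Notation matches := (matches e u0).

Lemma matches_sym g sg vs M : matches g sg vs M ->
  forall i j, (i < size M)%N -> (j < size M)%N -> zget M i j = zget M j i.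
Proof.
move=> [_ _ _ hM] i j ii jj; have := hM i j ii jj.
rewrite sym_e hM // !sgnpA addbC => /sgnp_inj -> //.
Qed.

Lemma matches_perm g sg vs B M g' p s : matches g sg vs B -> square M -> size M = size B ->
  all_perm_sgn M B g' p s ->
  exists g2 sg2 vs2, perm_eq vs2 vs /\ matches g2 sg2 vs2 M.
Proof.
move=> [us sv sqB hB] sqM sMB /andP[pp hp].
pose vs2 := map (nth u0 vs) p.
have vsE : map (nth u0 vs) (iota 0 (size M)) = vs by rewrite sMB -sv -[RHS](mkseq_nth u0).
have pvs : perm_eq vs2 vs by rewrite -[X in perm_eq _ X]vsE perm_map.
have uvs : uniq vs2 by rewrite (perm_uniq pvs).
have sz2 : size vs2 = size M by rewrite (perm_size pvs) sv sMB.
exists (g'.1 (+) g.1, g'.2 (+) g.2), (fun v => sg v (+) nth false s (index v vs2)), vs2.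
split=> //; split=> // i j ii jj.
have sp : size p = size M by rewrite (perm_size pp) size_iota.
have pl k : (k < size M)%N -> (nth 0%N p k < size B)%N.
  move=> kk; have : nth 0%N p k \in iota 0 (size M) by rewrite -(perm_mem pp) mem_nth ?sp.
  by rewrite mem_iota sMB => /andP[].
have vE k : (k < size M)%N -> nth u0 vs2 k = nth u0 vs (nth 0%N p k).
  by move=> kk; rewrite (nth_map 0%N) ?sp.
rewrite !index_uniq ?sz2 // -trp_trp !vE // hB ?pl // !trp_sgnp.
move/allP: hp => /(_ i); rewrite mem_iota ii => /(_ isT) /allP/(_ j).
rewrite mem_iota jj => /(_ isT).
move=> /zp_eqbP ->; rewrite !sgnpA; congr (sgnp _ _).
by case: (nth false s i); case: (nth false s j); case: (sg _); case: (sg _).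
Qed.

Definition grown (vs : seq 'I_n) := exists2 M, M \in reps & exists g sg vs2,
  perm_eq vs2 vs /\ matches g sg vs2 M.

Lemma leaf_grown g sg vs u M w c : size w = size M -> square M -> size vs = size M ->
  matches g sg (rcons vs u) (extend M w c) -> leaf reps M w c -> grown (rcons vs u).
Proof.
move=> sw sqM sv mB; rewrite /leaf.
have cB := matches_contracting weak_e mB.
have -> : refute 10 (extend M w c) (last_unit (size M)) (Zpos 1, Z0) = false.
  apply/negbTE; have -> : (Zpos 1, Z0) = normp (last_unit (size M)).
    by elim: (size M) => //= k IH; rewrite /normp /= -/(normp (last_unit k)) -IH.
  by apply: (refute_sound (R := R)) => //; rewrite size_extend // size_rcons size_nseq.
move=> /hasP[M' M'r]; case: eqP => // sM' /equivb_sound[g' [p [s h]]].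
exists M' => //; apply: matches_perm h => //; first exact: mB.
exact: (allP square_reps).
Qed.

(** The new vertex gets sign +, and [w] is its column in the coordinates of [M]. The rows of the
    extended matrix have norm at most 4, so [check_ext] does not drop this column, and
    [e u v != zp0] makes it nonzero. *)
Lemma grown_step vs u v : grown vs -> u \notin vs -> v \in vs -> e u v != zp0 ->
  grown (rcons vs u).
Proof.
move=> [M Mr [g [sg [vs2 [pvs mM]]]]] uvs vvs euv.
have [us sv sqM hM] := mM.
have uvs2 : u \notin vs2 by rewrite (perm_mem pvs).
pose sg' x := if x == u then false else sg x.
pose w := [seq sgnp (sg x) (trp g (e u x)) | x <- vs2].
pose c := trp g (e u u).
have sw : size w = size M by rewrite size_map.
have wE i : (i < size M)%N -> nth zp0 w i = sgnp (sg (nth u0 vs2 i)) (trp g (e u (nth u0 vs2 i))).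
  by move=> ii; rewrite (nth_map u0) ?sv.
have mB : matches g sg' (rcons vs2 u) (extend M w c).
  split; first by rewrite rcons_uniq uvs2.
  - by rewrite size_rcons size_extend // sv.
  - exact: square_extend.
  rewrite size_extend // => i j; rewrite !ltnS.
  have neu k : (k < size M)%N -> (nth u0 vs2 k == u) = false.
    by move=> kk; apply: contraNF uvs2 => /eqP <-; rewrite mem_nth ?sv.
  rewrite leq_eqVlt => /orP[/eqP -> | ii]; rewrite leq_eqVlt => /orP[/eqP -> | jj].
  - by rewrite !nth_rcons sv ltnn eqxx zget_extend_diag // /sg' eqxx.
  - rewrite !nth_rcons sv ltnn eqxx jj zget_extend_row // /sg' eqxx neu //=.
    by rewrite wE // sgnpK.
  - rewrite !nth_rcons sv ltnn eqxx ii zget_extend_col // /sg' eqxx neu //=.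
    by rewrite wE // sgnpK sym_e.
  by rewrite !nth_rcons sv ii jj zget_extend // /sg' !neu // hM.
have cB := matches_contracting weak_e mB.
have row i (t : R) : golden t -> (i < (size M).+1)%N ->
    ev t (normp (nth [::] (extend M w c) i)) <= 4.
  move=> gt ii; apply: contracting_row => //; first exact: square_extend.
    exact: matches_sym mB.
  by rewrite size_extend.
have rowi i (t : R) : golden t -> (i < size M)%N ->
    ev t (normp (nth [::] M i)) + ev t (nth zp0 w i) ^+ 2 <= 4.
  by move=> gt ii; rewrite -ev_normp_rcons // -(nth_extend c) // row // ltnS ltnW.
have rowl (t : R) : golden t -> ev t (normp w) + ev t c ^+ 2 <= 4.
  by move=> gt; rewrite -ev_normp_rcons // -(nth_extend_last c sw) row.
suff : grown (rcons vs2 u).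
  move=> [M' M'r [g2 [sg2 [vs3 [p3 m3]]]]]; exists M' => //; exists g2, sg2, vs3; split=> //.
  by rewrite (perm_trans p3) // -!cats1 perm_cat2r.
apply: (leaf_grown sw sqM sv mB).
have hck := check_reps Mr.
rewrite -[w]cat0s; apply: (check_ext_sound (R := R)) hck _ _ _ _ _ _.
- by rewrite size_map.
- move=> t gt; rewrite ev0 add0r.
  have -> : \sum_(x <- w) ev t x ^+ 2 = ev t (normp w); last exact: rowl.
  by rewrite ev_normp // (big_nth zp0) big_mkord.
- by move=> i; rewrite size_map => ii t gt; rewrite (nth_map [::]) //; apply: rowi.
- move=> x xw; have /(nthP zp0) := xw; case=> i; rewrite sw => ii <-; apply: (mem_alphabet (R := R)) => t gt.
  by apply: le_trans (rowi i t gt ii); rewrite lerDr ev_normp_ge0.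
- apply: (mem_alphabet (R := R)) => t gt.
  by apply: le_trans (rowl t gt); rewrite lerDr ev_normp_ge0.
rewrite cat0s; apply/negP => /allP w0; case/eqP: euv.
have v2 : v \in vs2 by rewrite (perm_mem pvs).
have iv : (index v vs2 < size M)%N by rewrite -sv index_mem.
have /zp_eqbP : zp_eqb zp0 (nth zp0 w (index v vs2)) by apply: w0; rewrite mem_nth ?sw.
rewrite wE // nth_index // => /esym/(congr1 (sgnp (sg v)))/=; rewrite sgnpK.
move=> /(congr1 (trp g)); rewrite trpK => ->.
by rewrite sgnp0 trp0.
Qed.
End Growth.

Lemma subgraphs_ok : all (fun ki =>
  [&& (ki.1 < size graphs)%N, uniq ki.2 & all (fun i => (i < size (nth [::] graphs ki.1))%N) ki.2])
  subgraphs.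
Proof. by vm_cast_no_check (erefl true). Qed.

Lemma seed_vertex x : x \in alphabet -> irrational x ->
  has (fun M => if size M == 1%N then equivb M [:: [:: x]] else false) reps.
Proof.
move=> xA ix; case/and3P: check_all_true => _ h _.
by move/allP: h => /(_ x xA); rewrite ix.
Qed.

Lemma seed_edge x a d : x \in alphabet -> a \in alphabet -> d \in alphabet -> irrational x ->
  leaf reps [:: [:: a]] [:: x] d.
Proof.
move=> xA aA dA ix; case/and3P: check_all_true => _ _ h.
by move/allP: h => /(_ x xA); rewrite ix => /allP/(_ a aA)/allP/(_ d dA).
Qed.

Section Classify.
Variables (R : rcfType) (n : nat) (e : 'I_n -> 'I_n -> zp).
Hypothesis weak_e : forall t : R, golden t -> contraction2 (emx e t).
Hypothesis sym_e : forall i j, e i j = e j i.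
Hypothesis conn_e : forall i j, connect [rel i j | e i j != zp0] i j.

Lemma entry_alphabet i j : e i j \in alphabet.
Proof.
apply: (mem_alphabet (R := R)) => t gt.
have := row_norm_le4 j (weak_e gt); rewrite (bigD1 i) //= mxE.
have : 0 <= \sum_(k < n | k != i) emx e t k j ^+ 2.
  by rewrite sumr_ge0 // => k _; apply: sqr_ge0.
by lra.
Qed.

Lemma grown_irrational u v : irrational (e u v) -> exists vs, grown e u vs.
Proof.
move=> iuv; have [uv|uv] := eqVneq u v.
  subst v; exists [:: u].
  have /hasP[M Mr] := seed_vertex (entry_alphabet u u) iuv.
  case: eqP => // sM /equivb_sound[g [p [s h]]]; exists M => //.
  have m0 : matches e u (false, false) (fun=> false) [:: u] [:: [:: e u u]].
    by split=> // -[|i] // [|j].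
  exact: matches_perm m0 (allP square_reps _ Mr) sM h.
exists (rcons [:: u] v).
have := seed_edge (entry_alphabet u v) (entry_alphabet u u) (entry_alphabet v v) iuv.
apply: (leaf_grown (g := (false, false)) (sg := fun=> false) weak_e) => //.
split=> //; first by rewrite /= inE uv.
by move=> [|[|i]] // [|[|j]] // _ _; rewrite /= sym_e.
Qed.

Lemma grown_full u v : irrational (e u v) -> exists2 vs, grown e u vs & vs =i predT.
Proof.
move=> iuv; have [vs0 gr0] := grown_irrational iuv.
have uniqg vs : grown e u vs -> uniq vs.
  by move=> [M _ [g [sg [vs2 [pv [uv _ _ _]]]]]]; rewrite -(perm_uniq pv).
have ne vs : grown e u vs -> vs != [::].
  move=> [M Mr [g [sg [vs2 [pv [_ sv _ _]]]]]]; apply/eqP => v0.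
  have : all (fun M => size M != 0%N) reps by vm_compute.
  by move=> /allP/(_ M Mr); rewrite -sv (perm_size pv) v0.
have [k] := ubnP (n - size vs0); elim: k vs0 gr0 => // k IH vs gr; rewrite ltnS => hk.
case: (boolP [forall x, x \in vs]) => [/forallP full|/forallPn[y yvs]].
  by exists vs => // x; rewrite full.
case: vs gr (ne _ gr) hk yvs => // x vs gr _ hk yvs.
have [a [b [avs bvs]]] := connect_exit (conn_e x y) (mem_head x vs) yvs.
rewrite /= sym_e => eab.
have gr2 := grown_step weak_e sym_e gr bvs avs eab.
have : (size (rcons (x :: vs) b) <= n)%N.
  by rewrite -(card_uniqP (uniqg _ gr2)) -[X in (_ <= X)%N]card_ord max_card.
rewrite size_rcons /= in hk * => ltn.
by apply: IH gr2 _; rewrite size_rcons /=; lia.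
Qed.

Lemma irrational_classification u v : irrational (e u v) ->
  exists k, (k < size graphs)%N /\ exists (h : 'I_n -> 'I_(size (nth [::] graphs k))) g sg,
   injective h /\ forall i j, e i j = trp g (sgnp (sg i) (sgnp (sg j)
      (zget (nth [::] graphs k) (h i) (h j)))).
Proof.
move=> /grown_full[vs0 [M Mr [g [sg [vs [pv [us sv sqM hM]]]]]] full0].
have full x : x \in vs by rewrite (perm_mem pv) full0.
have /mapP[[k idx] kr ME] := Mr.
have /and3P[/= kk uidx /allP hidx] := allP subgraphs_ok _ kr.
exists k; split=> //.
have sidx : size idx = size vs by rewrite sv ME size_map.
have ii x : (index x vs < size idx)%N by rewrite sidx index_mem.
exists (fun x => Ordinal (hidx _ (mem_nth 0%N (ii x)))), g, sg; split.
  move=> x y /(congr1 val)/= /eqP; rewrite nth_uniq // => /eqP.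
  by move=> /(congr1 (nth x vs)); rewrite !nth_index.
move=> x y /=; have := hM (index x vs) (index y vs).
rewrite -sv !index_mem !full => /(_ isT isT); rewrite !nth_index // => E.
rewrite -[LHS](trpK g) E; congr (trp g (sgnp _ (sgnp _ _))).
by rewrite ME /zsub /zget (nth_map 0%N) // (nth_map 0%N).
Qed.
End Classify.

(** * Irrational maximal matrices *)

Definition sqr4b (S : zmat) : bool :=
  square S && (0 < size S)%N &&
  all (fun i => all (fun j => zp_eqb (zget S i j) (zget S j i) &&
     zp_eqb (dotp (nth [::] S i) (nth [::] S j)) (if i == j then (Zpos 4, Z0) else zp0))
   (iota 0 (size S))) (iota 0 (size S)).

(** Depends on the numbering and is stronger than connectedness, but it is a direct test, and the
    seven graphs pass it as they are numbered. *)
Definition connb (S : zmat) : bool :=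
  all (fun i => has (fun j => ~~ zp_eqb (zget S i.+1 j) zp0) (iota 0 i.+1)) (iota 0 (size S).-1).

Lemma graphs_ok : all (fun S => sqr4b S && connb S) graphs.
Proof. by vm_cast_no_check (erefl true). Qed.

Section Graphs.
Variable R : rcfType.
Local Notation graph k := (nth [::] graphs k).

Lemma ev_eq0 (t : R) x : golden t -> ev t x = 0 -> x = zp0.
Proof.
have phi0 y : ev (phi R) y = 0 -> y = zp0.
  by case: y => a b /zphi_eq0[] /= a0 b0; congr (_, _); lia.
move=> gt; have : (t - phi R) * (t - (1 - phi R)) = 0.
  by have gp := golden_phi R; rewrite /golden in gt gp; ring: gt gp.
move/eqP; rewrite mulf_eq0 !subr_eq0 => /orP[] /eqP -> //; first exact: phi0.
rewrite -ev_conj => /phi0; case: x => a b [h1 h2].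
by congr (_, _); lia.
Qed.

Section Fixed.
Variable k : nat.
Hypothesis kk : (k < size graphs)%N.
Local Notation m := (size (graph k)).

Lemma graphP : [/\ square (graph k), (0 < m)%N,
  forall i j, (i < m)%N -> (j < m)%N -> zget (graph k) i j = zget (graph k) j i &
  forall i j, (i < m)%N -> (j < m)%N ->
    dotp (nth [::] (graph k) i) (nth [::] (graph k) j) = if i == j then (Zpos 4, Z0) else zp0].
Proof.
have /andP[/andP[/andP[sq m0] /allP h] _] := allP graphs_ok _ (mem_nth [::] kk).
have hh i j : (i < m)%N -> (j < m)%N -> zp_eqb (zget (graph k) i j) (zget (graph k) j i) &&
     zp_eqb (dotp (nth [::] (graph k) i) (nth [::] (graph k) j)) (if i == j then (Zpos 4, Z0) else zp0).
  move=> ii jj; move: (h i); rewrite mem_iota ii => /(_ isT) /allP/(_ j).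
  by rewrite mem_iota jj => /(_ isT).
by split=> // i j ii jj; have /andP[/zp_eqbP a /zp_eqbP b] := hh i j ii jj.
Qed.

Lemma graph_conn i : (i < m)%N -> (0 < i)%N ->
  exists2 j, (j < i)%N & zget (graph k) i j != zp0.
Proof.
case: i => // i ii _.
have /andP[_ /allP/(_ i)] := allP graphs_ok _ (mem_nth [::] kk).
rewrite mem_iota leq0n add0n andTb; have -> : (i < m.-1)%N by lia.
move=> /(_ isT)/hasP[j]; rewrite mem_iota => /andP[_ ji] /zp_eqbP/eqP nz.
by exists j.
Qed.

Variables (g : bool * bool) (sg : 'I_m -> bool).
Definition gmx : 'M[R]_m := \matrix_(u, v)
  ev (phi R) (trp g (sgnp (sg u) (sgnp (sg v) (zget (graph k) u v)))).

Let t := if g.2 then 1 - phi R else phi R.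
Let gt : golden t.
Proof. by rewrite /t; case: g.2; [apply: golden_conj|]; apply: golden_phi. Qed.

Lemma gmxE u v : gmx u v = (-1) ^+ g.1 * ((-1) ^+ sg u * ((-1) ^+ sg v * ev t (zget (graph k) u v))).
Proof. by rewrite mxE ev_trp !ev_sgn. Qed.

Lemma gmx_sym : gmx^T = gmx.
Proof.
have [_ _ sym _] := graphP.
by apply/matrixP => u v; rewrite mxE !gmxE sym //; ring.
Qed.

Lemma gmx_sqr : gmx *m gmx = 4%:M.
Proof.
have [sq _ sym dot] := graphP.
apply/matrixP => u v; rewrite !mxE.
transitivity ((-1) ^+ sg u * (-1) ^+ sg v * ev t (dotp (nth [::] (graph k) u) (nth [::] (graph k) v))).
  have sz w : (w < m)%N -> size (nth [::] (graph k) w) = m.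
    by move=> ww; apply/eqP; apply: (allP sq); rewrite mem_nth.
  rewrite ev_dotp // ?sz // mulr_sumr; apply: eq_bigr => w _.
  rewrite !gmxE -!/(zget _ _ _) (sym v w) //.
  have a1 : (-1) ^+ g.1 * (-1) ^+ g.1 = 1 :> R by rewrite -expr2 sqrr_sign.
  have a2 : (-1) ^+ sg w * (-1) ^+ sg w = 1 :> R by rewrite -expr2 sqrr_sign.
  ring: a1 a2.
rewrite dot // val_eqE; case: eqP => [->|_]; last by rewrite ev0 mulr0.
by rewrite -expr2 sqrr_sign mul1r /ev /zr /= mul0r addr0.
Qed.

Lemma gmx_Zphi : over_Zphi gmx.
Proof. by move=> u v; rewrite mxE /ev; do 2!eexists. Qed.

Lemma gmx_indec : indecomposable gmx.
Proof.
have [_ m0 _ _] := graphP; split=> //.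
have c0 (u : 'I_m) : connect (mx_adj gmx) (Ordinal m0) u.
  have [l] := ubnP u; elim: l u => // l IH u; rewrite ltnS => ul.
  have [u0|u0] := posnP u; first by rewrite (_ : u = Ordinal m0) //; apply: val_inj.
  have [j ju nz] := graph_conn (ltn_ord u) u0.
  have jm := ltn_trans ju (ltn_ord u).
  apply: (connect_trans (IH (Ordinal jm) (leq_trans ju ul))).
  apply: connect1; apply/andP; split.
    by apply/eqP => /(congr1 val)/= e; rewrite e ltnn in ju.
  have [_ _ sym _] := graphP.
  rewrite gmxE !mulf_neq0 ?signr_eq0 //; rewrite sym //.
  by apply: contraNneq nz => /(ev_eq0 gt) ->.
move=> u v; apply: connect_trans (c0 v).
by rewrite (sym_connect_sym (mx_adj_sym gmx_sym)).
Qed.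

Lemma gmx_maximal : maximal_indec_cyc_Zphi gmx.
Proof. by apply: maximal_sqr4; [exact: gmx_Zphi|exact: gmx_indec|exact: gmx_sym|exact: gmx_sqr]. Qed.
End Fixed.
End Graphs.

Section Noninteger.
Variable R : rcfType.
Local Notation graph k := (nth [::] graphs k).

Lemma noninteger_embeds n (A : 'M[R]_n) : indec_cyc_Zphi A -> ~ over_Z A ->
  exists k, (k < size graphs)%N /\ exists (h : 'I_n -> 'I_(size (graph k))) g sg,
    injective h /\ forall i j, A i j = gmx R g sg (h i) (h j).
Proof.
move=> [ZA [[n0 cA] cycA]] nZ; have [A1 [A2 AE]] := over_Zphi_zmx ZA.
move: cycA; rewrite AE => /contraction2_conj[[c1 c2] [s1 s2]].
pose e i j : zp := (Z_of_int (A1 i j), Z_of_int (A2 i j)).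
have evE (t : R) i j : ev t (e i j) = (A1 i j)%:~R + t * (A2 i j)%:~R.
  by rewrite /ev /zr /= !Z_of_intK mulrC.
have emxE (t : R) : emx e t = zmx t A1 A2 by apply/matrixP => i j; rewrite !mxE evE.
have weak (t : R) : golden t -> contraction2 (emx e t).
  move=> gt; rewrite emxE; have : (t - phi R) * (t - phib R) = 0.
    by have gp := golden_phi R; rewrite phibE; rewrite /golden in gt gp; ring: gt gp.
  by move/eqP; rewrite mulf_eq0 !subr_eq0 => /orP[] /eqP ->.
have sym i j : e i j = e j i by rewrite /e -{1}s1 -{1}s2 !mxE.
have Ae i j : A i j = ev (phi R) (e i j) by rewrite AE evE !mxE.
have conn i j : connect [rel i j | e i j != zp0] i j.
  apply: connect_sub (cA i j) => x y /andP[_ Axy]; apply: connect1 => /=.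
  by apply: contraNneq Axy => e0; rewrite Ae e0 ev0.
have [u [v iuv]] : exists u v, irrational (e u v).
  apply: NNPP => h; apply: nZ => i j; exists (A1 i j); rewrite AE !mxE.
  have -> : A2 i j = 0; last by rewrite mulr0 addr0.
  apply: NNPP => nz; apply: h; exists i, j; apply/Z.eqb_spec => /= h0; apply: nz; lia.
have [k [kk [h [g [sg [hinj hE]]]]]] := irrational_classification weak sym conn iuv.
(* The signs are carried along [h] to the vertices of the graph; a vertex outside the image of [h]
   gets sign +. *)
exists k; split=> //; exists h, g, (fun w => if [pick i | h i == w] is Some i then sg i else false).
split=> // i j; rewrite -AE Ae hE mxE.
have pk x : (if [pick i | h i == h x] is Some i then sg i else false) = sg x.
  by case: pickP => [y /eqP/hinj ->|/(_ x)/eqP].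
by rewrite !pk.
Qed.

Lemma size_graph_le8 k : (size (graph k) <= 8)%N.
Proof.
have h : all (fun S : zmat => size S <= 8)%N graphs by vm_cast_no_check (erefl true).
case: (ltnP k (size graphs)) => kk; first exact: (allP h _ (mem_nth _ kk)).
by rewrite nth_default.
Qed.

Lemma noninteger_size n (A : 'M[R]_n) : indec_cyc_Zphi A -> ~ over_Z A -> (n <= 8)%N.
Proof.
move=> iA nZ; have [k [_ [h [_ [_ [hinj _]]]]]] := noninteger_embeds iA nZ.
by apply: leq_trans (size_graph_le8 k); have := leq_card h hinj; rewrite !card_ord.
Qed.

Definition graph_mx k : 'M[R]_(size (graph k)) := \matrix_(i, j) ev (phi R) (zget (graph k) i j).

Lemma sgnm_mul n m (s : 'I_n -> bool) (h : 'I_n -> 'I_m) (X : 'M[R]_m) i j :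
  let Q : 'M[int]_(n, m) := \matrix_(i, u) ((-1) ^+ s i * (h i == u)%:R) in
  (imx R Q *m X *m (imx R Q)^T) i j = (-1) ^+ s i * (-1) ^+ s j * X (h i) (h j).
Proof.
move=> Q; rewrite mxE (bigD1 (h j)) //= big1 ?addr0 => [|v /negPf vj].
  rewrite mxE (bigD1 (h i)) //= big1 ?addr0 => [|u /negPf ui].
    by rewrite !mxE !eqxx !mulr1 !rmorphXn /= !rmorphN1; ring.
  by rewrite !mxE eq_sym ui mulr0 mul0r.
by rewrite !mxE [h j == v]eq_sym vj mulr0 mulr0.
Qed.

Lemma sgnm_orth n m (s : 'I_n -> bool) (h : 'I_n -> 'I_m) : bijective h ->
  let Q : 'M[int]_(n, m) := \matrix_(i, u) ((-1) ^+ s i * (h i == u)%:R) in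
  Q *m Q^T = 1%:M /\ Q^T *m Q = 1%:M.
Proof.
move=> [h' hK h'K] Q; split; apply/matrixP => i j; rewrite !mxE.
  rewrite (bigD1 (h i)) //= big1 ?addr0 => [|v /negPf vj].
    rewrite !mxE eqxx mulr1 (can_eq hK) [j == i]eq_sym; case: eqP => [->|_].
      by rewrite mulr1 -expr2 sqrr_sign.
    by rewrite mulr0 mulr0.
  by rewrite !mxE eq_sym vj mulr0 mul0r.
rewrite (bigD1 (h' i)) //= big1 ?addr0 => [|v vj].
  rewrite !mxE h'K eqxx mulr1; case: eqP => [->|_].
    by rewrite mulr1 -expr2 sqrr_sign.
  by rewrite mulr0 mulr0.
rewrite !mxE (_ : (h v == i) = false) ?mulr0 ?mul0r //.
by apply: contraNF vj => /eqP <-; rewrite hK.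
Qed.

Lemma noninteger_maximal n (A : 'M[R]_n) : maximal_indec_cyc_Zphi A -> ~ over_Z A ->
  exists2 k, (k < size graphs)%N & mx_equiv A (graph_mx k).
Proof.
move=> [iA maxA] nZ; have [k [kk [h [g [sg [hinj hE]]]]]] := noninteger_embeds iA nZ.
exists k => //.
have bij : bijective h.
  (* If [h] missed a vertex, [gmx] would be a proper indecomposable cyclotomic extension of [A]. *)
  apply: (inj_card_bij hinj); rewrite !card_ord leqNgt; apply/negP => ltm.
  apply: maxA; exists (size (graph k)), (gmx R g sg); split; first by have [] := gmx_maximal R kk g sg.
  by split=> //; exists h; split=> //; apply/matrixP => i j; rewrite mxE.
pose s i := sg (h i).
pose X := (-1) ^+ g.1 *: graph_mx k.
suff : strongly_equiv A X.
  rewrite /X; case: g.1; first by rewrite scaleN1r; right.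
  by rewrite scale1r; left.
have [Q1 Q2] := sgnm_orth s bij.
eexists; split; [exact: Q1|split; [exact: Q2|]].
set Q := \matrix_(i, u) _.
have QX i j : (imx R Q *m X *m (imx R Q)^T) i j =
    ev (phi R) (sgnp g.1 (sgnp (s i) (sgnp (s j) (zget (graph k) (h i) (h j))))).
  by rewrite sgnm_mul !mxE !ev_sgn; ring.
case: (boolP g.2) => [g2|/negPf g2]; [right|left].
  pose y i j := sgnp g.1 (sgnp (s i) (sgnp (s j) (zget (graph k) (h i) (h j)))).
  exists (\matrix_(i, j) int_of_Z (y i j).1), (\matrix_(i, j) int_of_Z (y i j).2).
  split; apply/matrixP => i j; first by rewrite QX !mxE /ev [_ * phi R]mulrC.
  have -> : A i j = ev (phib R) (y i j).
    by rewrite hE mxE /trp g2 phibE /y !ev_sgn ev_conj !ev_sgn.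
  by rewrite !mxE /ev mulrC.
by apply/matrixP => i j; rewrite QX hE mxE /trp g2.
Qed.

Lemma zget_wgraph k ch es (i j : 'I_k) :
  ev (phi R) (zget (wgraphp k ch es) i j) =
  wgraph k (map (ev (phi R)) ch) (map (fun d => (d.1, ev (phi R) d.2)) es) i j.
Proof.
rewrite /zget /wgraphp (nth_map 0%N) ?size_iota // (nth_map 0%N) ?size_iota // !nth_iota // !add0n.
rewrite mxE -val_eqE /=; case: ifP => _.
  case: (ltnP i (size ch)) => h; first by rewrite (nth_map zp0).
  by rewrite !nth_default ?size_map // ev0.
elim: es => [|[uv w] es IH] /=; first by rewrite big_nil ev0.
by rewrite big_cons /=; case: ifP => _ //; rewrite evD IH.
Qed.

Lemma evE1 : ev (phi R) (Zpos 1, Z0) = 1. Proof. by rewrite /ev /zr /= mul0r addr0. Qed.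
Lemma evF : ev (phi R) (Z0, Zpos 1) = phi R. Proof. by rewrite /ev /zr /= mul1r add0r. Qed.
Lemma evG : ev (phi R) (Zpos 1, Zneg 1) = phib R.
Proof. by rewrite /ev /zr /= phibE mulN1r. Qed.
Lemma evE1' : ev (phi R) (Zneg 1, Z0) = -1. Proof. by rewrite /ev /zr /= mul0r addr0. Qed.
Lemma evF' : ev (phi R) (Z0, Zneg 1) = - phi R.
Proof. by rewrite /ev /zr /= mulN1r add0r. Qed.
Lemma evG' : ev (phi R) (Zneg 1, Zpos 1) = - phib R.
Proof. by rewrite /ev /zr /= phibE mul1r opprB addrC. Qed.
Definition evEs := (evE1, evF, evG, evE1', evF', evG', ev0).

Lemma graph_mxE d : let m := d.1.1 in
  \matrix_(i < m, j < m) ev (phi R) (zget (wgraphp d.1.1 d.1.2 d.2) i j) =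
  wgraph m (map (ev (phi R)) d.1.2) (map (fun d => (d.1, ev (phi R) d.2)) d.2).
Proof. by apply/matrixP => i j; rewrite mxE zget_wgraph. Qed.

Theorem noninteger_classification n (A : 'M[R]_n) : maximal_indec_cyc_Zphi A -> ~ over_Z A ->
  mx_equiv A (S3 R) \/ mx_equiv A (S4_1 R) \/ mx_equiv A (S4_2 R) \/
  mx_equiv A (S4_3 R) \/ mx_equiv A (S6 R) \/ mx_equiv A (S8_dagdag R) \/
  mx_equiv A (S8_ddag R).
Proof.
move=> mA nZ; have [k kk eqv] := noninteger_maximal mA nZ.
have S0 : S3 R = graph_mx 0 by rewrite [RHS](graph_mxE (nth (0%N, [::], [::]) graph_data 0)) /S3 /= !evEs.
have S1 : S4_1 R = graph_mx 1 by rewrite [RHS](graph_mxE (nth (0%N, [::], [::]) graph_data 1)) /= !evEs.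
have S2 : S4_2 R = graph_mx 2 by rewrite [RHS](graph_mxE (nth (0%N, [::], [::]) graph_data 2)) /= !evEs.
have S3 : S4_3 R = graph_mx 3 by rewrite [RHS](graph_mxE (nth (0%N, [::], [::]) graph_data 3)) /= !evEs.
have S4 : S6 R = graph_mx 4 by rewrite [RHS](graph_mxE (nth (0%N, [::], [::]) graph_data 4)) /= !evEs.
have S5 : S8_dagdag R = graph_mx 5 by rewrite [RHS](graph_mxE (nth (0%N, [::], [::]) graph_data 5)) /= !evEs.
have S6 : S8_ddag R = graph_mx 6 by rewrite [RHS](graph_mxE (nth (0%N, [::], [::]) graph_data 6)) /= !evEs.
rewrite S0 S1 S2 S3 S4 S5 S6.
do 6![case: k kk eqv => [|k] kk eqv; [by left|right]].
by case: k kk eqv => [|k] kk eqv.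
Qed.
End Noninteger.

(** * Root representations of integer matrices *)

Section Dot.
Variable N : nat.
Implicit Types u v w : 'rV[int]_N.

Definition dotr u v : int := \sum_s u 0 s * v 0 s.
Definition evec (s : 'I_N) : 'rV[int]_N := delta_mx 0 s.

Lemma dotrC u v : dotr u v = dotr v u.
Proof. by apply: eq_bigr => s _; rewrite mulrC. Qed.
Lemma dotrDl u v w : dotr (u + v) w = dotr u w + dotr v w.
Proof. by rewrite -big_split; apply: eq_bigr => s _; rewrite mxE mulrDl. Qed.
Lemma dotrZl a u v : dotr (a *: u) v = a * dotr u v.
Proof. by rewrite mulr_sumr; apply: eq_bigr => s _; rewrite mxE mulrA. Qed.
Lemma dotrNl u v : dotr (- u) v = - dotr u v.
Proof. by rewrite -scaleN1r dotrZl mulN1r. Qed.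
Lemma dotrBl u v w : dotr (u - v) w = dotr u w - dotr v w.
Proof. by rewrite dotrDl dotrNl. Qed.
Lemma dotrDr u v w : dotr u (v + w) = dotr u v + dotr u w.
Proof. by rewrite !(dotrC u) dotrDl. Qed.
Lemma dotrZr a u v : dotr u (a *: v) = a * dotr u v.
Proof. by rewrite !(dotrC u) dotrZl. Qed.
Lemma dotrBr u v w : dotr u (v - w) = dotr u v - dotr u w.
Proof. by rewrite !(dotrC u) dotrBl. Qed.
Lemma dot0r v : dotr 0 v = 0.
Proof. by rewrite /dotr big1 // => s _; rewrite mxE mul0r. Qed.
Lemma dotr_suml (I : finType) (P : pred I) (F : I -> 'rV[int]_N) v :
  dotr (\sum_(i | P i) F i) v = \sum_(i | P i) dotr (F i) v.
Proof.
apply: (big_morph (fun u => dotr u v)); first by move=> x y; apply: dotrDl.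
exact: dot0r.
Qed.
Lemma dotr_sumr (I : finType) (P : pred I) (F : I -> 'rV[int]_N) v :
  dotr v (\sum_(i | P i) F i) = \sum_(i | P i) dotr v (F i).
Proof. by rewrite dotrC dotr_suml; apply: eq_bigr => i _; rewrite dotrC. Qed.

Lemma dotr_unit s v : dotr (evec s) v = v 0 s.
Proof.
rewrite /dotr (bigD1 s) //= big1 ?addr0 => [|t /negPf ts]; first by rewrite mxE !eqxx mul1r.
by rewrite mxE eqxx ts mul0r.
Qed.

Lemma dotr_ge0 v : 0 <= dotr v v.
Proof. by apply: sumr_ge0 => s _; rewrite -expr2 sqr_ge0. Qed.

Lemma evecE s t : evec s 0 t = (t == s)%:R.
Proof. by rewrite mxE eqxx. Qed.

Lemma sqr_le_dotr v s : v 0 s ^+ 2 <= dotr v v.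
Proof.
rewrite /dotr (bigD1 s) //= -expr2 lerDl; apply: sumr_ge0 => t _.
by rewrite -expr2 sqr_ge0.
Qed.

Lemma dotr_eq0 v : dotr v v = 0 -> v = 0.
Proof.
move=> v0; apply/rowP => s; rewrite mxE; apply/eqP; rewrite -sqrf_eq0 eq_le sqr_ge0 andbT.
by rewrite -v0 sqr_le_dotr.
Qed.

Lemma norm1_unit v : dotr v v = 1 -> exists s a, a ^+ 2 = 1 /\ v = a *: evec s.
Proof.
move=> v1; have /rV0Pn[s vs] : v != 0 by apply/eqP => v0; rewrite v0 dot0r in v1.
exists s, (v 0 s).
have h := sqr_le_dotr v s; rewrite v1 in h.
have a1 : v 0 s ^+ 2 = 1.
  by apply/eqP; rewrite eq_le h /=; move: vs; set x := v 0 s => vs; nia.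
split=> //; apply/eqP; rewrite -subr_eq0; apply/eqP/dotr_eq0.
rewrite !(dotrBl, dotrBr) !(dotrZl, dotrZr) !dotr_unit (dotrC v) dotr_unit v1.
by rewrite evecE eqxx mulr1 -expr2 a1 subrr.
Qed.

Lemma norm2_units v : dotr v v = 2 -> exists s t a b,
  [/\ s != t, a ^+ 2 = 1, b ^+ 2 = 1 & v = a *: evec s + b *: evec t].
Proof.
move=> v2; have /rV0Pn[s vs] : v != 0 by apply/eqP => v0; rewrite v0 dot0r in v2.
have h := sqr_le_dotr v s; rewrite v2 in h.
have a1 : v 0 s ^+ 2 = 1.
  move: h vs; set x := v 0 s => h /eqP x0.
  have x1 : -1 <= x <= 1 by nia.
  by have [->|->] : x = 1 \/ x = -1 by lia.
have [t [b [b1 e]]] : exists t b, b ^+ 2 = 1 /\ v - v 0 s *: evec s = b *: evec t.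
  apply: norm1_unit.
  rewrite !(dotrBl, dotrBr) !(dotrZl, dotrZr) !dotr_unit (dotrC v) dotr_unit v2.
  by rewrite evecE eqxx mulr1 -expr2 a1 subrr subr0.
exists s, t, (v 0 s), b; split=> //; last by rewrite -e addrC subrK.
apply/eqP => st; subst t; have /rowP/(_ s) := e; rewrite !mxE !eqxx !mulr1 subrr => b0.
by rewrite -b0 in b1.
Qed.
End Dot.

(** For an integer vector with [m] coordinates, sum [Z] and squared norm [X], the number
    [X - Z ^ 2 / m] is the squared norm of its projection orthogonal to the all-one vector. The
    bounds improve in turn, [Z <= 4], [X <= 3], [X <= 2], [X <= B], because [Z ^ 2 / m] shrinks each
    time. The bound 10 is sharp: [m = 9], [X = Z = 3], [B = 2] satisfies all other hypotheses, and
    is the glue vector of A_8 in E_8. *)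
Lemma small_norm (m X Z B : int) : 10 <= m -> 0 <= B <= 2 -> - m <= 2 * Z <= m ->
  Z <= X -> - Z <= X -> m * X - Z ^+ 2 <= B * m -> X <= B.
Proof.
wlog Z0 : Z / 0 <= Z => [hw|].
  case: (lerP 0 Z) => [|Z0]; first exact: hw.
  move=> m10 B02 hm h1 h2 h3; apply: (hw (- Z)); rewrite ?sqrrN //; lia.
move=> m10 /andP[B0 B2] hm ZX _; rewrite expr2 => hK.
have m0 : 0 <= m by lia.
have le_of_mul (x y : int) : m * x <= m * y + 9 -> x <= y.
  by move=> h; case: (lerP x y) => // xy; have := ler_wpM2l m0 (_ : y + 1 <= x); lia.
have h1 := ler_wpM2l m0 ZX.
have h2 : Z * (2 * Z) <= Z * m by apply: ler_wpM2l => //; lia.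
have h3 := ler_wpM2l m0 B2.
have Z4 : Z <= 4 by apply: le_of_mul; lia.
have X3 : X <= 3.
  apply: le_of_mul; have : Z * Z <= 4 * 4 by apply: ler_pM.
  lia.
have X2 : X <= 2.
  apply: le_of_mul; have : Z * Z <= 3 * 3 by apply: ler_pM => //; lia.
  lia.
apply: le_of_mul; have : Z * Z <= 2 * 2 by apply: ler_pM => //; lia.
lia.
Qed.

(** * Integral vectors representing bounded functionals *)

Section Dual.
Variables (N : nat) (T : finType) (I : {set T}) (g : T -> 'rV[int]_N) (S : {set 'I_N}).
Local Notation e := (@evec N).

Definition lin v := exists y : T -> int, v = \sum_(i in I) y i *: g i.

(* The root lattice of type A, resp. D, on the coordinates in [S] is contained in the span of
   the vectors [g i]. *)
Definition stateA := (forall s t, s \in S -> t \in S -> lin (e s - e t)) /\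
  (forall i, i \in I -> \sum_s g i 0 s = 0).
Definition stateD := forall s t, s \in S -> t \in S -> lin (e s + e t).

Hypothesis suppS : forall i s, i \in I -> s \notin S -> g i 0 s = 0.
Hypothesis S10 : (10 <= #|S|)%N.

Section Functional.
Variables (c : T -> int) (B : int).
Hypothesis B02 : 0 <= B <= 2.
Hypothesis bounded : forall y : T -> int, (\sum_(i in I) y i * c i) ^+ 2 <=
  B * dotr (\sum_(i in I) y i *: g i) (\sum_(i in I) y i *: g i).

(* The graph of the linear functional [g i |-> c i] on the span of the vectors [g i]; it is a
   function by [lr_bound]. *)
Definition lr v k := exists y : T -> int,
  v = \sum_(i in I) y i *: g i /\ k = \sum_(i in I) y i * c i.

Lemma lin_lr v : lin v -> exists k, lr v k.
Proof. by move=> [y ->]; exists (\sum_(i in I) y i * c i), y. Qed.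

Lemma lrD v w k l : lr v k -> lr w l -> lr (v + w) (k + l).
Proof.
move=> [y [-> ->]] [x [-> ->]]; exists (fun i => y i + x i).
by rewrite -!big_split; split; apply: eq_bigr => i _ /=; rewrite ?scalerDl ?mulrDl.
Qed.

Lemma lrZ a v k : lr v k -> lr (a *: v) (a * k).
Proof.
move=> [y [-> ->]]; exists (fun i => a * y i).
by rewrite scaler_sumr mulr_sumr; split; apply: eq_bigr => i _ /=; rewrite ?scalerA ?mulrA.
Qed.

Lemma lrB v w k l : lr v k -> lr w l -> lr (v - w) (k - l).
Proof. by move=> h1 h2; rewrite -scaleN1r -[- l]mulN1r; apply/lrD/lrZ. Qed.

Lemma lr0 : lr 0 0.
Proof. by exists (fun=> 0); rewrite !big1 // => i _; rewrite ?scale0r ?mul0r. Qed.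

Lemma lr_sum (J : finType) (P : pred J) F k : (forall j, P j -> lr (F j) (k j)) ->
  lr (\sum_(j | P j) F j) (\sum_(j | P j) k j).
Proof.
move=> h; apply: (big_rec2 lr) => [|j v w Pj]; first exact: lr0.
exact/lrD/h.
Qed.

Lemma lr_gen i : i \in I -> lr (g i) (c i).
Proof.
move=> iI; exists (fun j => (j == i)%:R); split.
  rewrite (bigD1 i) //= eqxx scale1r big1 ?addr0 // => j /andP[_ /negPf ->].
  by rewrite scale0r.
rewrite (bigD1 i) //= eqxx mul1r big1 ?addr0 // => j /andP[_ /negPf ->].
by rewrite mul0r.
Qed.

Lemma lr_bound v k : lr v k -> k ^+ 2 <= B * dotr v v.
Proof. by move=> [y [-> ->]]. Qed.

Lemma lr_fun v k l : lr v k -> lr v l -> k = l.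
Proof.
move=> h1 h2; have := lr_bound (lrB h1 h2); rewrite subrr dot0r mulr0.
by move=> h; apply/eqP; rewrite -subr_eq0 -sqrf_eq0 eq_le h sqr_ge0.
Qed.

Lemma dotr_supp (v : 'rV[int]_N) i : i \in I -> dotr v (g i) = \sum_(s in S) v 0 s * g i 0 s.
Proof.
move=> iI; rewrite /dotr (bigID (mem S)) /= [X in _ + X]big1 ?addr0 // => s sS.
by rewrite suppS // mulr0.
Qed.

Lemma g_expand i : i \in I -> g i = \sum_(s in S) g i 0 s *: e s.
Proof.
move=> iI; rewrite [LHS]row_sum_delta (bigID (mem S)) /= [X in _ + X]big1 ?addr0 // => s sS.
by rewrite suppS // scale0r.
Qed.

Lemma dot_comb (x : 'I_N -> int) :
  dotr (\sum_(s in S) x s *: e s) (\sum_(s in S) x s *: e s) = \sum_(s in S) x s ^+ 2.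
Proof.
rewrite dotr_suml; apply: eq_bigr => s sS; rewrite dotrZl dotr_unit summxE (bigD1 s) //=.
rewrite mxE evecE eqxx mulr1 big1 ?addr0 ?expr2 // => t /andP[_ /negPf ts].
by rewrite mxE evecE eq_sym ts mulr0.
Qed.

Lemma comb_coord (x : 'I_N -> int) t :
  (\sum_(s in S) x s *: e s) 0 t = if t \in S then x t else 0.
Proof.
rewrite summxE; case: ifP => tS.
  rewrite (bigD1 t) //= mxE evecE eqxx mulr1 big1 ?addr0 // => s /andP[_ /negPf st].
  by rewrite mxE evecE eq_sym st mulr0.
rewrite big1 // => s sS; rewrite mxE evecE; case: eqP => [E|_]; last by rewrite mulr0.
by rewrite E sS in tS.
Qed.

(** Needed twice: with [B = 2] for the functional given by the inner products of a new root, and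
    with [B = 1] for a coordinate composed with an automorphism. *)
Definition dual_vector := exists z : 'rV[int]_N,
  [/\ forall s, s \notin S -> z 0 s = 0, forall i, i \in I -> dotr z (g i) = c i & dotr z z <= B].

(* Twice the coordinates of the vector representing the functional are integers of the same
   parity; were they odd, the vector would have norm at least [#|S| / 4 > B]. *)
Lemma dualD : stateD -> dual_vector.
Proof.
move=> hD.
have /fin_all_exists[d dP] : forall s, exists k, s \in S -> lr (e s + e s) k.
  move=> s; case: (boolP (s \in S)) => [sS|_]; last by exists 0.
  by have [k hk] := lin_lr (hD s s sS sS); exists k.
have par s t : s \in S -> t \in S -> exists k, d s + d t = 2 * k.
  move=> sS tS; have [k hk] := lin_lr (hD s t sS tS); exists k.
  apply: (lr_fun (lrD (dP s sS) (dP t tS))).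
  by have := lrZ 2 hk; congr lr; rewrite scaler_nat mulr2n addrACA.
pose Q := \sum_(s in S) d s ^+ 2.
(* The bound is applied to a multiple of the vector that represents the functional, where
   Cauchy-Schwarz is sharp. Since [d s] is the value at [2 e_s], this yields [Q ^ 2 <= 4 B Q]. *)
have hQ : lr (\sum_(s in S) (2 * d s) *: e s) Q.
  apply: lr_sum => s sS; have := lrZ (d s) (dP s sS).
  by rewrite -expr2; congr lr; rewrite -mulr2n -scaler_nat scalerA mulrC.
have Q8 : Q <= 4 * B.
  have := lr_bound hQ; rewrite dot_comb.
  have -> : \sum_(s in S) (2 * d s) ^+ 2 = 4 * Q.
    by rewrite mulr_sumr; apply: eq_bigr => s _; rewrite exprMn.
  have : 0 <= Q by apply: sumr_ge0 => s _; apply: sqr_ge0.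
  by move=> *; nia.
have even s : s \in S -> exists k, d s = 2 * k.
  move=> sS; case: (boolP (2 %| d s)%Z) => [/dvdzP[k ->]|odds]; first by exists k; rewrite mulrC.
  exfalso; have : (#|S|%:Z <= Q).
    have -> : #|S|%:Z = \sum_(s in S) 1 by rewrite sumr_const natz.
    apply: ler_sum => t tS.
    have [k hk] := par s t sS tS; have : d t != 0.
      apply: contra odds => /eqP t0; rewrite t0 addr0 in hk; apply/dvdzP; exists k; lia.
    by set x := d t; nia.
  by move=> *; lia.
have /fin_all_exists[z zP] : forall s, exists k, s \in S -> d s = 2 * k.
  move=> s; case: (boolP (s \in S)) => [sS|_]; last by exists 0.
  by have [k hk] := even s sS; exists k.
exists (\sum_(s in S) z s *: e s); split.
- by move=> s /negPf sS; rewrite comb_coord sS.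
- move=> i iI; have h1 := lrZ 2 (lr_gen iI).
  have h2 : lr (2 *: g i) (\sum_(s in S) g i 0 s * d s).
    rewrite {1}(g_expand iI) scaler_sumr; apply: lr_sum => s sS.
    have := lrZ (g i 0 s) (dP s sS); congr lr.
    by rewrite -mulr2n -scaler_nat !scalerA mulrC.
  have := lr_fun h1 h2; rewrite dotr_supp //.
  have -> : \sum_(s in S) g i 0 s * d s =
     2 * (\sum_(s in S) (\sum_(s0 in S) z s0 *: e s0) 0 s * g i 0 s).
    rewrite mulr_sumr; apply: eq_bigr => s sS; rewrite comb_coord sS zP //; ring.
  by move=> E; apply/esym/(mulfI (_ : (2 : int) != 0)).
rewrite dot_comb; have : Q = 4 * \sum_(s in S) z s ^+ 2.
  by rewrite mulr_sumr; apply: eq_bigr => s sS; rewrite zP // exprMn.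
by move: Q8; set X := \sum_(s in S) z s ^+ 2 => *; lia.
Qed.

(* Here the representing vector is determined up to a multiple of the all-one vector only: [a]
   is the integer nearest to the mean of its coordinates. *)
Lemma dualA : stateA -> dual_vector.
Proof.
move=> [hA hsum]; have [s0 s0S] : exists s0, s0 \in S by apply/card_gt0P; lia.
have /fin_all_exists[d dP] : forall s, exists k, s \in S -> lr (e s - e s0) k.
  move=> s; case: (boolP (s \in S)) => [sS|_]; last by exists 0.
  by have [k hk] := lin_lr (hA s s0 sS s0S); exists k.
pose m : int := #|S|%:Z; pose D := \sum_(s in S) d s; pose Q := \sum_(s in S) d s ^+ 2.
pose K := m * Q - D ^+ 2.
have sumc (x : int) : \sum_(s in S) x = m * x by rewrite sumr_const -mulr_natl natz.
have hK : lr (\sum_(s in S) (m * d s - D) *: e s) K.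
  have -> : K = \sum_(s in S) (m * d s - D) * d s.
    under eq_bigr => s _ do rewrite mulrBl -mulrA -expr2.
    by rewrite sumrB -!mulr_sumr -/D -/Q /K expr2.
  have -> : \sum_(s in S) (m * d s - D) *: e s = \sum_(s in S) (m * d s - D) *: (e s - e s0).
    under [RHS]eq_bigr => s _ do rewrite scalerBr.
    rewrite sumrB -scaler_suml sumrB -mulr_sumr sumc -/D subrr scale0r subr0 //.
  by apply: lr_sum => s sS; apply/lrZ/dP.
have KB : K <= B * m.
  have := lr_bound hK; rewrite dot_comb.
  have -> : \sum_(s in S) (m * d s - D) ^+ 2 = m * K.
    under eq_bigr => s _ do rewrite sqrrB exprMn.
    rewrite big_split sumrB /= sumc -mulr_sumr -/Q.
    have -> : \sum_(s in S) m * d s * D *+ 2 = m * D * D *+ 2.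
      by rewrite sumrMnl -mulr_suml -mulr_sumr.
    by rewrite /K mulr2n; ring.
  have : 0 <= B by lia.
  have : 0 < m by rewrite /m; lia.
  by move=> *; nia.
have m10 : 10 <= m by rewrite /m; lia.
have [a ha] : exists a : int, - m <= 2 * (D - a * m) <= m.
  exists ((2 * D + m) %/ (2 * m))%Z.
  have := divz_eq (2 * D + m) (2 * m); have := modz_ge0 (2 * D + m) (_ : 2 * m != 0).
  have := ltz_pmod (2 * D + m) (_ : 0 < 2 * m).
  set q := (_ %/ _)%Z; set r := (_ %% _)%Z => h1 h2 h3.
  have := h1 ltac:(lia); have := h2 ltac:(lia); lia.
pose z s := d s - a; pose Z := \sum_(s in S) z s; pose X := \sum_(s in S) z s ^+ 2.
have ZE : Z = D - a * m by rewrite /Z /z sumrB sumc mulrC.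
have XE : X = Q - 2 * a * D + m * a ^+ 2.
  rewrite /X /z; under eq_bigr => s _ do rewrite sqrrB.
  rewrite big_split sumrB /= sumc -/Q; congr (_ - _ + _).
  by rewrite sumrMnl -mulr_suml -/D mulr2n; ring.
have KE : K = m * X - Z ^+ 2 by rewrite /K XE ZE; ring.
have X1 : Z <= X by apply: ler_sum => s _; set x := z s; nia.
have X2 : - Z <= X by rewrite -sumrN; apply: ler_sum => s _; set x := z s; nia.
have XB : X <= B by apply: (small_norm m10 B02 _ X1 X2); rewrite ?ZE // -?KE // -ZE -KE.
exists (\sum_(s in S) z s *: e s); split.
- by move=> s /negPf sS; rewrite comb_coord sS.
- move=> i iI; have h1 := lr_gen iI.
  have sg : \sum_(s in S) g i 0 s = 0.
    have := hsum i iI; rewrite (bigID (mem S)) /= [X in _ + X]big1 ?addr0 // => s sS.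
    exact: suppS.
  have h2 : lr (g i) (\sum_(s in S) g i 0 s * d s).
    have gE : g i = \sum_(s in S) g i 0 s *: (e s - e s0).
      under eq_bigr => s _ do rewrite scalerBr.
      by rewrite sumrB -scaler_suml sg scale0r subr0 -g_expand.
    by rewrite {1}gE; apply: lr_sum => s sS; apply/lrZ/dP.
  rewrite (lr_fun h1 h2) dotr_supp //.
  transitivity (\sum_(s in S) (g i 0 s * d s - g i 0 s * a)).
    by apply: eq_bigr => s sS; rewrite comb_coord sS /z; ring.
  by rewrite sumrB -mulr_suml sg mul0r subr0.
by rewrite dot_comb.
Qed.
End Functional.
End Dual.

Lemma sum_indic (R : pzSemiRingType) (T : finType) (x : T) (F : T -> R) :
  \sum_i (i == x)%:R * F i = F x.
Proof.
rewrite (bigD1 x) //= eqxx mul1r big1 ?addr0 // => i /negPf ->.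
by rewrite mul0r.
Qed.

Section Lin.
Variables (N : nat) (T : finType).
Implicit Types (I : {set T}) (g : T -> 'rV[int]_N).

Lemma linD I g v w : lin I g v -> lin I g w -> lin I g (v + w).
Proof.
move=> [y ->] [x ->]; exists (fun i => y i + x i).
by rewrite -big_split; apply: eq_bigr => i _; rewrite scalerDl.
Qed.

Lemma linZ I g a v : lin I g v -> lin I g (a *: v).
Proof.
move=> [y ->]; exists (fun i => a * y i).
by rewrite scaler_sumr; apply: eq_bigr => i _; rewrite scalerA.
Qed.

Lemma linN I g v : lin I g v -> lin I g (- v).
Proof. by rewrite -scaleN1r; apply: linZ. Qed.

Lemma linB I g v w : lin I g v -> lin I g w -> lin I g (v - w).
Proof. by move=> h1 /linN; apply: linD. Qed.

Lemma lin0 I g : lin I g 0.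
Proof. by exists (fun=> 0); rewrite big1 // => i _; rewrite scale0r. Qed.

Lemma lin_gen I g i : i \in I -> lin I g (g i).
Proof.
move=> iI; exists (fun j => (j == i)%:R).
rewrite (bigD1 i) //= eqxx scale1r big1 ?addr0 // => j /andP[_ /negPf ->].
by rewrite scale0r.
Qed.

Lemma lin_mono I (J : {set T}) g h v : {subset I <= J} -> {in I, g =1 h} -> lin I g v -> lin J h v.
Proof.
move=> IJ gh [y ->]; elim/big_rec: _ => [|i w iI hw]; first exact: lin0.
by apply: linD hw; apply: linZ; rewrite gh //; apply/lin_gen/IJ.
Qed.
End Lin.

(** * Adding roots one at a time *)

Section Growth.
Variables (T : finType) (G : T -> T -> int) (N : nat).
Hypothesis symG : forall i j, G i j = G j i.
Hypothesis diagG : forall i, G i i = 2.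
Hypothesis psdG : forall y : T -> int, 0 <= \sum_i \sum_j y i * y j * G i j.
Implicit Types (I : {set T}) (g : T -> 'rV[int]_N) (S : {set 'I_N}).
Local Notation e := (@evec N).

Definition gram I g := forall i j, i \in I -> j \in I -> dotr (g i) (g j) = G i j.

(** The lower bound on [#|S|] is what [dualA] and [dualD] require. The upper bound leaves a
    coordinate outside [S] as long as [I] is not everything and [#|T| < N]. *)
Definition root_repr I g S := [/\ gram I g, forall i s, i \in I -> s \notin S -> g i 0 s = 0,
  stateA I g S \/ stateD I g S, (10 <= #|S|)%N & (#|S| <= #|I|.+1)%N].

(* Discriminant of the Gram form on the plane spanned by [x] and [\sum_i y i *: g i]. *)
Lemma gram_bounded I g x : gram I g -> x \notin I -> forall y : T -> int,
  (\sum_(i in I) y i * G x i) ^+ 2 <= 2 * dotr (\sum_(i in I) y i *: g i) (\sum_(i in I) y i *: g i).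
Proof.
move=> gG xI y; set K := \sum_(i in I) _.
pose f i := if i \in I then y i else 0.
have restr (F : T -> int) : \sum_i f i * F i = \sum_(i in I) y i * F i.
  by rewrite [RHS]big_mkcond; apply: eq_bigr => i _; rewrite /f; case: ifP => _; rewrite ?mul0r.
have := psdG (fun i => - K * (i == x)%:R + 2 * f i).
have -> : \sum_i \sum_j (- K * (i == x)%:R + 2 * f i) * (- K * (j == x)%:R + 2 * f j) * G i j =
   K ^+ 2 * 2 - 4 * K * K + 4 * \sum_i f i * \sum_j f j * G i j.
  under eq_bigr => i _.
    have -> : \sum_j (- K * (i == x)%:R + 2 * f i) * (- K * (j == x)%:R + 2 * f j) * G i j =
     (i == x)%:R * (K ^+ 2 * G i x - 2 * K * \sum_j f j * G i j) +
      (- 2 * K * (f i * G i x) + 4 * (f i * \sum_j f j * G i j)).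
      transitivity (\sum_j ((- K * (i == x)%:R + 2 * f i) * - K * ((j == x)%:R * G i j) +
                            (- K * (i == x)%:R + 2 * f i) * 2 * (f j * G i j))).
        by apply: eq_bigr => j _; ring.
      rewrite big_split -!mulr_sumr sum_indic /=.
      have [->|_] := eqVneq i x; rewrite ?mulr1n ?mulr0n /f; last by ring.
      by rewrite (negPf xI); ring.
    over.
  rewrite big_split sum_indic /= diagG big_split -!mulr_sumr /=.
  have -> : \sum_j f j * G x j = K by rewrite restr.
  have -> : \sum_i f i * G i x = K by rewrite restr; apply: eq_bigr => i _; rewrite symG.
  by ring.
have -> : \sum_i f i * \sum_j f j * G i j =
    dotr (\sum_(i in I) y i *: g i) (\sum_(i in I) y i *: g i).
  rewrite restr dotr_suml; apply: eq_bigr => i iI; rewrite dotrZl; congr (_ * _).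
  by rewrite restr dotr_sumr; apply: eq_bigr => j jI; rewrite dotrZr gG.
lia.
Qed.

(** The vector [z] with the prescribed inner products is nonzero, because [x] has a neighbour in
    [I], and has norm 1 or 2. If the norm is 2, [z] itself is the new root. If it is 1, [z] is plus
    or minus a unit vector, and a fresh unit vector [e f], orthogonal to all earlier roots, is added
    to or subtracted from it. *)
Lemma root_repr_extend I g S x : (#|T| < N)%N -> root_repr I g S -> x \notin I ->
  (exists2 i, i \in I & G x i != 0) ->
  exists g' S', root_repr (x |: I) g' S'.
Proof.
move=> TN [gG supp st S10 SI] xI [i0 i0I Gx0].
have [z [zS zG z2]] : dual_vector I g S (G x) 2.
  have bd := gram_bounded gG xI.
  case: st => st; [apply: dualA | apply: dualD] => //.
have card1 : #|x |: I| = #|I|.+1 by rewrite cardsU1 xI.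
pose upd r t : 'rV[int]_N := if t == x then r else g t.
have updI r : {in I, g =1 upd r}.
  by move=> i iI; rewrite /upd; case: eqP => // ix; rewrite -ix iI in xI.
have updx r : upd r x = r by rewrite /upd eqxx.
have sub : {subset I <= x |: I} by move=> i iI; rewrite in_setU1 iI orbT.
have mono r v : lin I g v -> lin (x |: I) (upd r) v by apply: lin_mono.
have linr r : lin (x |: I) (upd r) r.
  by rewrite -{2}(updx r); apply: lin_gen; rewrite setU11.
have gramr r : dotr r r = 2 -> (forall i, i \in I -> dotr r (g i) = G x i) ->
    gram (x |: I) (upd r).
  move=> r2 rG i j /setU1P[->|iI] /setU1P[->|jI]; rewrite ?updx -?updI ?r2 ?diagG ?rG ?gG //.
  by rewrite dotrC rG.
have z0 : z != 0 by apply: contraNneq Gx0 => z0; rewrite -zG // z0 dot0r.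
have zpos : 0 < dotr z z.
  by rewrite lt_neqAle dotr_ge0 andbT eq_sym; apply: contraNneq z0 => /dotr_eq0 ->.
have zsupp s : z 0 s != 0 -> s \in S by apply: contraNT => /zS ->.
have [z1|z1] : dotr z z = 1 \/ dotr z z = 2 by lia.
  have [s [a [a1 zE]]] := norm1_unit z1.
  have aE : a = 1 \/ a = -1.
    by move/eqP: a1; rewrite sqrf_eq1 => /orP[] /eqP ->; [left|right].
  have sS : s \in S.
    by apply: zsupp; rewrite zE mxE evecE eqxx mulr1; case: aE => ->.
  have [f fS] : exists f, f \notin S.
    apply/existsP; rewrite -negb_forall; apply/negP => /forallP h.
    have : (N <= #|S|)%N by rewrite -[X in (X <= _)%N]card_ord; apply/subset_leq_card/subsetP => u _.
    have := max_card (mem (x |: I)); rewrite card1; lia.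
  have fs : (f == s) = false by apply: contraNF fS => /eqP ->.
  have zf : z 0 f = 0 by apply: zS.
  have ef i : i \in I -> dotr (e f) (g i) = 0 by move=> iI; rewrite dotr_unit supp.
  have cardf : #|f |: S| = #|S|.+1 by rewrite cardsU1 fS.
  have normr (b : int) : b ^+ 2 = 1 -> dotr (z + b *: e f) (z + b *: e f) = 2.
    move=> b1; rewrite !(dotrDl, dotrDr) !(dotrZl, dotrZr) !dotr_unit (dotrC z) !dotr_unit.
    by rewrite zf evecE eqxx z1 !mulr0 add0r mulr1 -expr2 b1 addr0.
  have gr (b : int) i : i \in I -> dotr (z + b *: e f) (g i) = G x i.
    by move=> iI; rewrite dotrDl dotrZl ef // mulr0 addr0 zG.
  have sp (b : int) i u : i \in x |: I -> u \notin f |: S -> upd (z + b *: e f) i 0 u = 0.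
    rewrite in_setU1 => iI; rewrite in_setU1 negb_or => /andP[/negPf uf uS].
    case/predU1P: iI => [->|iI]; last by rewrite -updI // supp.
    by rewrite updx mxE zS // mxE evecE uf mulr0 addr0.
  suff [b b1 stb] : exists2 b : int, b ^+ 2 = 1 &
      stateA (x |: I) (upd (z + b *: e f)) (f |: S) \/ stateD (x |: I) (upd (z + b *: e f)) (f |: S).
    exists (upd (z + b *: e f)), (f |: S); split=> //.
    - by apply: gramr; [exact: normr | exact: gr].
    - exact: sp.
    - by rewrite cardf; lia.
    by rewrite cardf card1; lia.
  case: st => [[hA hsum]|hD].
    (* The opposite sign keeps the coordinate sum 0, so the type remains A. *)
    exists (- a); first by rewrite sqrrN.
    have hf t : t \in S -> lin (x |: I) (upd (z + - a *: e f)) (e f - e t).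
      move=> tS; have -> : e f - e t = (e s - e t) - a *: (z + - a *: e f).
        rewrite zE scalerDr !scalerA (_ : a * a = 1) ?scale1r; last by rewrite -expr2.
        rewrite (_ : a * - a = -1); last by rewrite mulrN -expr2 a1.
        by rewrite scaleN1r opprB [RHS]addrC addrA subrK.
      by apply: linB; [apply/mono/hA | apply/linZ/linr].
    left; split=> [u t|i].
      rewrite !in_setU1 => /predU1P[->|uS] /predU1P[->|tS].
      - by rewrite subrr; apply: lin0.
      - exact: hf.
      - by rewrite -opprB; apply/linN/hf.
      exact/mono/hA.
    rewrite in_setU1 => /predU1P[->|iI].
      rewrite updx zE; under eq_bigr => u _ do rewrite !mxE eqxx /=.
      rewrite big_split -!mulr_sumr /=.
      have sume (v : 'I_N) : \sum_u (u == v)%:R = 1 :> int.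
        by rewrite (bigD1 v) //= eqxx big1 ?addr0 // => u /negPf ->.
      by rewrite !sume mulr1 mulr1 subrr.
    by under eq_bigr do rewrite -updI //; apply: hsum.
  exists 1; rewrite ?expr1n // scale1r; right.
  have hf t : t \in S -> lin (x |: I) (upd (z + e f)) (e f + e t).
    move=> tS; have -> : e f + e t = (z + e f) + (e t - z) by rewrite addrC [RHS]addrC addrA subrK.
    apply: linD; first exact: linr.
    apply: mono; rewrite zE; case: aE => ->; rewrite ?scaleN1r ?scale1r ?opprK; last exact: hD.
    have -> : e t - e s = (e t + e t) - (e s + e t) by rewrite opprD addrCA addrK addrC.
    by apply: linB; apply: hD.
  move=> u t; rewrite !in_setU1 => /predU1P[->|uS] /predU1P[->|tS].
  - have -> : e f + e f = 2 *: (z + e f) - (z + z) by rewrite scaler_nat mulr2n addrACA [RHS]addrC addKr.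
    apply: linB; first exact/linZ/linr.
    by rewrite zE -scalerDr; apply/linZ/mono/hD.
  - exact: hf.
  - by rewrite (addrC (e u)); apply: hf.
  exact/mono/hD.
have [s [t [a [b [st' a1 b1 zE]]]]] := norm2_units z1.
exists (upd z), S; split=> //.
- exact: gramr.
- move=> i u /setU1P[->|iI] uS; first by rewrite updx zS.
  by rewrite -updI // supp.
- case: st => [[hA hsum]|hD]; last first.
    by right=> u v uS vS; apply/mono/hD.
  have sE (c : int) : c ^+ 2 = 1 -> c = 1 \/ c = -1.
    by move/eqP; rewrite sqrf_eq1 => /orP[] /eqP ->; [left|right].
  (* A root [+- (e_s - e_t)] keeps type A; a root [+- (e_s + e_t)] turns it into type D. *)
  have [ab|ab] : b = - a \/ b = a by case: (sE a a1) (sE b b1) => -> [] ->; auto.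
    left; split=> [u v uS vS|i /setU1P[->|iI]]; first exact/mono/hA.
      rewrite updx zE ab; under eq_bigr => u _ do rewrite !mxE eqxx /=.
      rewrite big_split -!mulr_sumr /=.
      have sume (v : 'I_N) : \sum_u (u == v)%:R = 1 :> int.
        by rewrite (bigD1 v) //= eqxx big1 ?addr0 // => u /negPf ->.
      by rewrite !sume !mulr1 subrr.
    by under eq_bigr do rewrite -updI //; apply: hsum.
  right=> u v uS vS.
  have sS : s \in S.
    apply: zsupp; rewrite zE !mxE !eqxx (negPf st') /= mulr1 mulr0 addr0.
    by case: (sE a a1) => ->.
  have tS : t \in S.
    apply: zsupp; rewrite zE !mxE !eqxx [t == s]eq_sym (negPf st') /= mulr1 mulr0 add0r.
    by case: (sE b b1) => ->.
  have -> : e u + e v = a *: z + ((e u - e s) + (e v - e t)).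
    rewrite zE ab -scalerDr scalerA -expr2 a1 scale1r [in RHS]addrC addrACA.
    by rewrite !subrK.
  apply: linD; first exact/linZ/linr.
  by apply: linD; apply/mono/hA.
by rewrite card1; lia.
Qed.
End Growth.

(** * Induced paths in graphs of bounded degree *)

Section InducedPath.
Local Open Scope nat_scope.
Variables (T : finType) (r : rel T) (t0 : T) (d : nat).
Hypothesis sym_r : symmetric r.
Hypothesis conn_r : forall i j, connect r i j.
Hypothesis deg_r : forall t, #|[set s | r t s]| <= d.

Fixpoint ball k : {set T} :=
  if k is k'.+1 then ball k' :|: \bigcup_(x in ball k') [set y | r x y] else [set t0].

Lemma card_ball k : #|ball k| <= d.+1 ^ k.
Proof.
elim: k => [|k IH] /=; first by rewrite cards1.
have h : #|\bigcup_(x in ball k) [set y | r x y]| <= #|ball k| * d.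
  rewrite -sum_nat_const; elim/big_rec2: _ => [|x n B xb hB]; first by rewrite cards0.
  by apply: leq_trans (leq_card_setU _ _) _; apply: leq_add.
apply: leq_trans (leq_card_setU _ _) _; rewrite expnS mulSn leq_add //.
by apply: leq_trans h _; rewrite mulnC leq_mul2l IH orbT.
Qed.

Lemma ball_mono i j : i <= j -> ball i \subset ball j.
Proof.
elim: j => [|j IH]; first by rewrite leqn0 => /eqP ->.
rewrite leq_eqVlt => /orP[/eqP ->//|/IH h]; exact: subset_trans h (subsetUl _ _).
Qed.

Lemma ball_step k x y : x \in ball k -> r x y -> y \in ball k.+1.
Proof. by move=> xb xy /=; rewrite in_setU; apply/orP; right; apply/bigcupP; exists x; rewrite ?inE. Qed.

Lemma ball_grow k : d.+1 ^ k < #|T| -> exists x, (x \in ball k.+1) && (x \notin ball k).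
Proof.
move=> hk; have [y yb] : exists y, y \notin ball k.
  apply/existsP; rewrite -negb_forall; apply/negP => /forallP h.
  have : #|T| <= #|ball k| by apply/subset_leq_card/subsetP => u _.
  by rewrite leqNgt (leq_ltn_trans (card_ball k)).
have t0b : t0 \in ball k by apply: (subsetP (ball_mono (leq0n k))); rewrite /= set11.
have [a [b [ab bb rab]]] := connect_exit (conn_r t0 y) t0b yb.
by exists b; rewrite bb (ball_step ab rab).
Qed.

(** The sphere of radius [k] about [t0]. *)
Definition layer k x := (x \in ball k) && ((0 < k) ==> (x \notin ball k.-1)).

Lemma layer_path k x : layer k x -> exists p : nat -> T, [/\ p k = x,
  forall i, i <= k -> layer i (p i) & forall i, i < k -> r (p i) (p i.+1)].
Proof.
elim: k x => [|k IH] x lx.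
  by exists (fun=> x); split=> // i; rewrite leqn0 => /eqP ->.
have /andP[xb /= xnb] := lx.
have [y yb ryx] : exists2 y, y \in ball k & r y x.
  by move: xb; rewrite /= in_setU (negPf xnb) => /bigcupP[y yb]; rewrite inE; exists y.
have ly : layer k y.
  apply/andP; split=> //; apply/implyP => k0; apply: contra xnb => yb'.
  by rewrite -(prednK k0); apply: ball_step yb' ryx.
have [p [pk pl pr]] := IH y ly.
exists (fun i => if i == k.+1 then x else p i); split; first by rewrite eqxx.
  move=> i; rewrite leq_eqVlt => /orP[/eqP ->|ik]; first by rewrite eqxx.
  by rewrite (ltn_eqF ik); apply: pl.
move=> i; rewrite ltnS => ik; rewrite (ltn_eqF (_ : i < k.+1)) // eqSS.
by case: eqP => [->|/eqP ne]; [rewrite pk | apply: pr; rewrite ltn_neqAle ne].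
Qed.

(** The ball of radius [l] is not everything, so there is a vertex at distance [l + 1] from [t0]. A
    shortest path to it is induced: its [i]-th vertex has distance [i] from [t0], and adjacent
    vertices have distances that differ by at most 1. *)
Lemma induced_path l : d.+1 ^ l < #|T| -> exists p : nat -> T,
  [/\ forall i, i < l.+1 -> r (p i) (p i.+1),
      forall i j, i < j -> j <= l.+1 -> p i != p j &
      forall i j, i.+1 < j -> j <= l.+1 -> ~~ r (p i) (p j)].
Proof.
move=> /ball_grow[x xl]; have [p [_ pl pr]] := layer_path (xl : layer l.+1 x).
exists p; split=> // i j ij jl.
  have /andP[_ /implyP/(_ (leq_trans (leq_ltn_trans (leq0n i) ij) (leqnn j)))] := pl j jl.
  have /andP[pi _] := pl i (leq_trans (ltnW ij) jl).
  apply: contraNneq => <-; apply: (subsetP (ball_mono _)) pi.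
  by rewrite -ltnS prednK // (leq_ltn_trans _ ij).
have j0 : 0 < j by rewrite (leq_ltn_trans _ ij).
have /andP[_ /implyP/(_ j0)] := pl j jl.
have /andP[pi _] := pl i (leq_trans (ltnW (ltnW ij)) jl).
apply: contra => rij; apply: (subsetP (ball_mono _)) (ball_step pi rij).
by rewrite -ltnS prednK.
Qed.
End InducedPath.

Section Represent.
Variables (T : finType) (G : T -> T -> int).
Hypothesis symG : forall i j, G i j = G j i.
Hypothesis diagG : forall i, G i i = 2.
Hypothesis psdG : forall y : T -> int, 0 <= \sum_i \sum_j y i * y j * G i j.
Hypothesis offG : forall i j, i != j -> G i j != 0 -> G i j ^+ 2 = 1.
Definition adjG : rel T := fun i j => (i != j) && (G i j != 0).
Hypothesis connG : forall i j, connect adjG i j.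
Variable d : nat.
Hypothesis degG : forall t, (#|[set s | adjG t s]| <= d)%N.
Hypothesis largeT : (d.+1 ^ 7 + 10 < #|T|)%N.

Local Notation N := #|T|.+1.
Local Notation e k := (@evec N (inord k)).

(* An induced path with 9 vertices spans a root lattice of type A on 10 coordinates, enough to
   exclude the exceptional root lattices. *)
Lemma path_repr : exists I (g : T -> 'rV[int]_N) S, root_repr G I g S.
Proof.
have /card_gt0P[t0 _] : (0 < #|T|)%N by apply: leq_ltn_trans largeT.
have lt7 : (d.+1 ^ 7 < #|T|)%N by apply: leq_ltn_trans largeT; apply: leq_addr.
have N10 : (10 < #|T|)%N by apply: leq_ltn_trans largeT; apply: leq_addl.
(* For [l = 7] the vertices of the path are [p 0] to [p 8]. *)
have [p [pr pne pna]] := induced_path t0 connG degG lt7.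
have inj i j : (i < 9)%N -> (j < 9)%N -> p i = p j -> i = j.
  move=> i9 j9 pij; case: (ltngtP i j) => // h.
    by have := pne i j h j9; rewrite pij eqxx.
  by have := pne j i h i9; rewrite pij eqxx.
have Gadj i j : (i < j)%N -> (j < 9)%N -> G (p i) (p j) = 0 \/
    (j = i.+1 /\ G (p i) (p j) ^+ 2 = 1).
  move=> ij j9; have [->|ne] := eqVneq j i.+1.
    by right; split=> //; have /andP[h1 h2] := pr i (leq_trans ij j9); apply: offG.
  left; have /pna/(_ j9) : (i.+1 < j)%N by rewrite ltn_neqAle eq_sym ne.
  by rewrite /adjG pne //= negbK => /eqP.
(* The vectors [e_k - e_(k+1)] have consecutive inner products -1, while those in [G] are 1 or -1;
   these signs make them agree. *)
pose sig := fix sig k : int := if k is k'.+1 then - sig k' * G (p k') (p k'.+1) else 1.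
have sig2 k : (k < 9)%N -> sig k ^+ 2 = 1.
  elim: k => [|k IH] k9; first by rewrite expr1n.
  have [|E|[_ E]] := Gadj k k.+1 _ k9; first exact: ltnSn.
    by have /andP[_] := pr k k9; rewrite E eqxx.
  by rewrite /= exprMn sqrrN IH ?(ltnW k9) // E mulr1.
pose v k : 'rV[int]_N := sig k *: (e k - e k.+1).
have vE k s : v k 0 s = sig k * ((s == inord k)%:R - (s == inord k.+1)%:R).
  by rewrite /v !mxE !eqxx.
pose g t := if [pick k : 'I_9 | p k == t] is Some k then v k else 0.
have gE k : (k < 9)%N -> g (p k) = v k.
  move=> k9; rewrite /g; case: pickP => [j /eqP/inj -> //|/(_ (Ordinal k9))].
  by rewrite /= eqxx.
have valE k : (k < 10)%N -> (inord k : 'I_N) = k :> nat.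
  by move=> k10; rewrite inordK //; lia.
have ee i j : (i < 10)%N -> (j < 10)%N -> dotr (e i) (e j) = (i == j)%:R.
  by move=> i10 j10; rewrite dotr_unit evecE -val_eqE /= !valE.
pose I := [set p k | k : 'I_9]; pose S : {set 'I_N} := [set inord k | k : 'I_10].
have card_I : #|I| = 9%N by rewrite card_imset ?card_ord // => i j /inj E; apply/val_inj/E.
have card_S : #|S| = 10%N.
  by rewrite card_imset ?card_ord // => i j /(congr1 val); rewrite /= !valE // => /val_inj.
have dv a b : (a <= b)%N -> (b < 9)%N -> dotr (v a) (v b) = G (p a) (p b).
  move=> ab b9; have a9 := leq_ltn_trans ab b9.
  have a10 := ltnW a9 : (a < 10)%N; have b10 := ltnW b9 : (b < 10)%N.
  rewrite /v dotrZl dotrZr !(dotrBl, dotrBr) !ee // eqSS.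
  move: ab; rewrite leq_eqVlt => /orP[/eqP ab|ab].
    subst b; rewrite eqxx diagG eqn_leq ltnn andbF eqn_leq ltnn /=.
    by rewrite mulrA -expr2 sig2 //.
  rewrite (ltn_eqF ab) (ltn_eqF (ltnW ab : (a < b.+1)%N)).
  case: (Gadj a b ab b9) => [G0|[bE G1]]; last first.
    subst b; rewrite eqxx /= [RHS](_ : _ = sig a ^+ 2 * G (p a) (p a.+1)); last by rewrite sig2 ?mul1r.
    by rewrite expr2; ring.
  rewrite G0; case: eqP => [abE|_]; last by rewrite !subr0 !mulr0.
  have a8 : (a < 8)%N by lia.
  by have /andP[_] := pr a a8; rewrite abE G0 eqxx.
exists I, g, S; split.
- move=> i j /imsetP[a _ ->] /imsetP[b _ ->]; rewrite !gE //.
  by case/orP: (leq_total a b) => h; [rewrite dv | rewrite dotrC dv // symG].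
- move=> i s /imsetP[a _ ->] sS; rewrite gE //.
  have es k : (k < 10)%N -> (s == inord k) = false.
    move=> k10; apply: contraNF sS => /eqP ->.
    by apply/imsetP; exists (Ordinal k10).
  have a9 := ltn_ord a.
  by rewrite vE (es a (ltnW a9 : (a < 10)%N)) (es a.+1 a9) subrr mulr0.
- left; split.
    have l0 k : (k < 10)%N -> lin I g (e 0 - e k).
      elim: k => [|k IH] k10; first by rewrite subrr; apply: lin0.
      have -> : e 0 - e k.+1 = (e 0 - e k) + (sig k *: g (p k)).
        by rewrite gE // /v scalerA -expr2 sig2 // scale1r addrA subrK.
      apply: linD; first exact/IH/ltnW.
      by apply/linZ/lin_gen/imsetP; exists (Ordinal (k10 : (k < 9)%N)).
    move=> s t /imsetP[a _ ->] /imsetP[b _ ->].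
    rewrite -(subrKA (e 0)) addrC -[_ - e 0]opprB.
    by apply: linB; apply: l0.
  move=> i /imsetP[a _ ->]; rewrite gE //.
  under eq_bigr => s _ do rewrite vE.
  rewrite -mulr_sumr sumrB.
  have sume (w : 'I_N) : \sum_u (u == w)%:R = 1 :> int.
    by rewrite (bigD1 w) //= eqxx big1 ?addr0 // => u /negPf ->.
  by rewrite !sume subrr mulr0.
- by rewrite card_S.
by rewrite card_S card_I.
Qed.

Lemma full_repr : exists (g : T -> 'rV[int]_N) S, root_repr G [set: T] g S.
Proof.
have [I0 [g0 [S0 r0]]] := path_repr.
have I0ne : exists i, i \in I0.
  by apply/card_gt0P; have [_ _ _ h1 h2] := r0; lia.
have [k] := ubnP (#|T| - #|I0|); elim: k I0 g0 S0 r0 I0ne => // k IH I g S rI [i iI].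
rewrite ltnS => hk; have [IT|] := eqVneq I [set: T]; first by subst I; exists g, S.
rewrite -subTset => /subsetPn[x _ xI].
have [a [b [aI bI /andP[_ ab]]]] := connect_exit (connG i x) iI xI.
have [|g' [S' rI']] := root_repr_extend symG diagG psdG (leqnn _) rI bI.
  by exists a; rewrite // symG.
apply: IH rI' _ _; first by exists b; rewrite setU11.
rewrite cardsU1 bI; have : (#|b |: I| <= #|T|)%N by apply: max_card.
by rewrite cardsU1 bI; lia.
Qed.
End Represent.

(** * Automorphisms of a root representation *)

Section Automorphism.
Variables (T : finType) (G : T -> T -> int) (N : nat) (g : T -> 'rV[int]_N) (S : {set 'I_N}).
Hypothesis rG : root_repr G [set: T] g S.
Variable tau : T -> T.
Hypothesis tauK : involutive tau.
Hypothesis tauG : forall i j, G (tau i) (tau j) = G i j.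
Local Notation e := (@evec N).

(** A single unit vector need not lie in the span. Two such vectors with different [t] separate [s]
    from all other coordinates. *)
Lemma lin_pair s t : s \in S -> t \in S -> s != t ->
  exists v, [/\ lin [set: T] g v, v 0 s = 1 & forall u, u != s -> u != t -> v 0 u = 0].
Proof.
move=> sS tS st; have [_ _ [[hA _]|hD] _ _] := rG.
  exists (e s - e t); split; first exact: hA.
    by rewrite !mxE !eqxx (negPf st) subr0.
  by move=> u /negPf us /negPf ut; rewrite !mxE us ut andbF subr0.
exists (e s + e t); split; first exact: hD.
  by rewrite !mxE !eqxx (negPf st) addr0.
by move=> u /negPf us /negPf ut; rewrite !mxE us ut andbF addr0.
Qed.

Lemma two_others s : s \in S -> exists t1 t2, [/\ t1 \in S, t2 \in S, s != t1, s != t2 & t1 != t2].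
Proof.
have [_ _ _ S10 _] := rG => sS.
have c1 : #|S :\ s| = #|S|.-1 by rewrite (cardsD1 s S) sS.
have /card_gt0P[t1 t1S] : (0 < #|S :\ s|)%N by rewrite c1; lia.
have c2 : #|(S :\ s) :\ t1| = #|S|.-2 by rewrite -c1 [in RHS](cardsD1 t1 (S :\ s)) t1S.
have /card_gt0P[t2 t2S] : (0 < #|(S :\ s) :\ t1|)%N by rewrite c2; lia.
move: t1S t2S; rewrite !inE => /andP[t1s t1S] /and3P[t21 t2s t2S].
by exists t1, t2; split=> //; rewrite eq_sym.
Qed.

(* The [s]-th coordinate composed with [tau] is again a functional of norm at most 1, hence plus
   or minus a coordinate. *)
Lemma coord_dual s : s \in S -> exists t a, [/\ t \in S, a ^+ 2 = 1 &
  forall i, g (tau i) 0 s = a * g i 0 t].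
Proof.
move=> sS; have [gG supp st S10 _] := rG.
have bd (y : T -> int) : (\sum_(i in [set: T]) y i * g (tau i) 0 s) ^+ 2 <=
   1 * dotr (\sum_(i in [set: T]) y i *: g i) (\sum_(i in [set: T]) y i *: g i).
  pose w := \sum_(i in [set: T]) y i *: g (tau i).
  have -> : \sum_(i in [set: T]) y i * g (tau i) 0 s = w 0 s.
    by rewrite summxE; apply: eq_bigr => i _; rewrite mxE.
  rewrite mul1r; apply: le_trans (sqr_le_dotr w s) _.
  rewrite /w !dotr_suml le_eqVlt; apply/orP; left; apply/eqP.
  apply: eq_bigr => i _; rewrite !dotrZl; congr (_ * _).
  rewrite !dotr_sumr; apply: eq_bigr => j _; rewrite !dotrZr; congr (_ * _).
  by rewrite !gG ?inE.
have [z [zS zG z1]] : dual_vector [set: T] g S (fun i => g (tau i) 0 s) 1.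
  by case: st => st; [apply: dualA | apply: dualD].
have z0 : z != 0.
  apply/eqP => z0; have [t [_ [tS _ st1 _ _]]] := two_others sS.
  have [v [[y vE] vs _]] := lin_pair sS tS st1.
  suff : v 0 s = 0 by rewrite vs.
  rewrite vE summxE big1 // => i _; rewrite mxE -(tauK i) -zG ?inE // z0 dot0r mulr0 //.
have {}z1 : dotr z z = 1.
  have : 0 < dotr z z; last by lia.
  by rewrite lt_neqAle dotr_ge0 andbT eq_sym; apply: contraNneq z0 => /dotr_eq0 ->.
have [t [a [a1 zE]]] := norm1_unit z1.
exists t, a; split=> //.
  apply: contraNT z0 => /zS; rewrite zE mxE evecE eqxx mulr1 => a0.
  by rewrite a0 scale0r.
by move=> i; rewrite -zG ?inE // zE dotrZl dotr_unit.
Qed.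

(** By [coord_dual], [tau] acts on the coordinates in [S] by a map [p] with signs [a]; the other
    coordinates are fixed. As [tau] is an involution, [v s = a s * a (p s) * v (p (p s))] for all
    [v] in the span, and the vectors of [lin_pair] turn this into [p (p s) = s] and
    [a s * a (p s) = 1]. *)
Lemma automorphism_mx : exists P : 'M[int]_N,
  [/\ P^T = P, P *m P = 1%:M & forall i, g (tau i) = g i *m P].
Proof.
have [gG supp st S10 _] := rG.
have /fin_all_exists[f fP] : forall s, exists ta : 'I_N * int,
    [/\ ta.2 ^+ 2 = 1, s \in S -> ta.1 \in S, s \notin S -> ta = (s, 1) &
     forall i, g (tau i) 0 s = ta.2 * g i 0 ta.1].
  move=> s; case: (boolP (s \in S)) => [sS|sS].
    by have [t [a [tS a1 h]]] := coord_dual sS; exists (t, a).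
  by exists (s, 1); split=> // i; rewrite mul1r !supp ?inE.
pose p s := (f s).1; pose a s := (f s).2.
have gE i s : g (tau i) 0 s = a s * g i 0 (p s) by have [_ _ _ ->] := fP s.
have a1 s : a s ^+ 2 = 1 by have [] := fP s.
have lin2 v s : lin [set: T] g v -> v 0 s = a s * a (p s) * v 0 (p (p s)).
  move=> [y ->]; rewrite !summxE mulr_sumr; apply: eq_bigr => i _.
  have E : g i 0 s = a s * a (p s) * g i 0 (p (p s)) by rewrite -[in LHS](tauK i) !gE mulrA.
  by rewrite !mxE E; ring.
have pp s : p (p s) = s /\ a s * a (p s) = 1.
  case: (boolP (s \in S)) => sS; last first.
    have [_ _ /(_ sS) E _] := fP s.
    have ps : p s = s by rewrite /p E.
    by rewrite !ps /a E mulr1.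
  have [t1 [t2 [t1S t2S st1 st2 t12]]] := two_others sS.
  (* One test vector leaves the possibility [p (p s) = t]; a second one with another [t] removes
     it. *)
  have hit t : t \in S -> s != t -> p (p s) = s /\ a s * a (p s) = 1 \/ p (p s) = t.
    move=> tS nst; have [v [vl vs v0]] := lin_pair sS tS nst.
    have := lin2 v s vl; have [->|ns] := eqVneq (p (p s)) s.
      by rewrite vs mulr1 => <-; left.
    have [->|nt] := eqVneq (p (p s)) t; first by right.
    by rewrite (v0 _ ns nt) vs mulr0.
  have [//|h1] := hit t1 t1S st1; have [//|h2] := hit t2 t2S st2.
  by case/eqP: t12; rewrite -h1.
have ppK s : p (p s) = s by case: (pp s).
have aa s : a (p s) = a s.
  have [_ h] := pp s; have := a1 s; rewrite expr2 => h'.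
  by rewrite -[LHS]mul1r -h' -mulrA h mulr1.
exists (\matrix_(t, s) (a s * (t == p s)%:R)); split.
- apply/matrixP => s t; rewrite !mxE.
  case: (eqVneq t (p s)) => [->|ne]; first by rewrite ppK eqxx aa.
  case: (eqVneq s (p t)) => [E|_]; last by rewrite !mulr0.
  by rewrite E ppK eqxx in ne.
- apply/matrixP => t s; rewrite !mxE (bigD1 (p s)) //= big1 ?addr0 => [|u /negPf us].
    rewrite !mxE eqxx mulr1 ppK aa; case: (t == s); last by rewrite mulr0 mul0r.
    by rewrite mulr1 -expr2 a1.
  by rewrite !mxE us !mulr0.
move=> i; apply/rowP => s; rewrite gE !mxE (bigD1 (p s)) //= big1 ?addr0 => [|u /negPf us].
  by rewrite !mxE eqxx mulr1 mulrC.
by rewrite !mxE us !mulr0.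
Qed.
End Automorphism.

(** * Completion to a matrix with square 4 *)

Lemma sqr_ge1 (x : int) : x != 0 -> 1 <= x ^+ 2.
Proof. by move=> x0; rewrite -gtz0_ge1 exprn_even_gt0 //= x0. Qed.

Lemma mulmx3_row k n (A : 'M[int]_(k, n)) (B : 'M[int]_n) i j :
  (A *m B *m A^T) i j = (row i A *m B *m (row j A)^T) 0 0.
Proof.
rewrite -row_mul [LHS]mxE [RHS]mxE; apply: eq_bigr => s _.
by rewrite [A^T _ _]mxE [row _ _ _ _]mxE [(row j A)^T _ _]mxE [row j A _ _]mxE.
Qed.

Section Frame.
Variable N : nat.

Definition frame k (U : 'M[int]_(k, N)) := U *m U^T = 2%:M.
(** For a frame this is twice the orthogonal projection onto the span of the rows. As the rows have
    entries 0, 1 and -1, the diagonal entry at [s] counts the rows that are nonzero at [s]. *)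
Definition cover k (U : 'M[int]_(k, N)) := U^T *m U.

Lemma cover_diag k (U : 'M[int]_(k, N)) s : cover U s s = \sum_i U i s ^+ 2.
Proof. by rewrite mxE; apply: eq_bigr => i _; rewrite mxE expr2. Qed.

Lemma cover_sqr k (U : 'M[int]_(k, N)) s : frame U -> \sum_t cover U s t ^+ 2 = 2 * cover U s s.
Proof.
move=> fU; have E : cover U *m cover U = 2 *: cover U.
  by rewrite /cover mulmxA -(mulmxA _ U) fU mul_mx_scalar -scalemxAl.
have /matrixP/(_ s s) := E; rewrite [in RHS]mxE => <-; rewrite [RHS]mxE.
apply: eq_bigr => t _; rewrite expr2; congr (_ * _).
by rewrite /cover -[in RHS](trmxK U) trmxK !mxE; apply: eq_bigr => i _; rewrite !mxE mulrC.
Qed.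

Lemma cover_le2 k (U : 'M[int]_(k, N)) s : frame U -> 0 <= cover U s s <= 2.
Proof.
move=> fU; have h0 : 0 <= cover U s s by rewrite cover_diag sumr_ge0 // => i _; apply: sqr_ge0.
rewrite h0 /=; have := cover_sqr s fU; rewrite (bigD1 s) //=.
have : 0 <= \sum_(i < N | i != s) cover U s i ^+ 2 by rewrite sumr_ge0 // => i _; apply: sqr_ge0.
rewrite expr2; set X := \sum_(i < N | _) _; set c := cover U s s in h0 * => X0 E.
case: (lerP c 2) => // c2; have := ler_wpM2l h0 (_ : 3 <= c); lia.
Qed.

Lemma frame_size k (U : 'M[int]_(k, N)) : frame U -> (k <= N)%N.
Proof.
move=> fU; have : \tr (U *m U^T) = \tr (U^T *m U) by rewrite mxtrace_mulC.
rewrite fU mxtrace_scalar => E.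
have : \tr (U^T *m U) <= \sum_(s < N) 2.
  by apply: ler_sum => s _; have /andP[] := cover_le2 s fU.
by rewrite -E sumr_const card_ord ler_pMn2l.
Qed.

Lemma row_dotr k (U : 'M[int]_(k, N)) i j : (U *m U^T) i j = dotr (row i U) (row j U).
Proof. by rewrite mxE; apply: eq_bigr => s _; rewrite !mxE. Qed.

(* The only row covering [s] is [a e_s + b e_t]; then [a e_s - b e_t] is orthogonal to all rows. *)
Lemma frame_extend k (U : 'M[int]_(k, N)) s : frame U -> cover U s s = 1 ->
  exists r : 'rV[int]_N, frame (col_mx U r).
Proof.
move=> fU c1.
have [i Uis] : exists i, U i s != 0.
  case: (pickP (fun i => U i s != 0)) => [i Ui|h]; first by exists i.
  have : cover U s s = 0; last by rewrite c1.
  by rewrite cover_diag big1 // => i _; have /negbFE/eqP -> := h i; rewrite expr0n.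
have others j : j != i -> U j s = 0.
  move=> ji; move: c1; rewrite cover_diag (bigD1 i) //= (bigD1 j) //=.
  set X := \sum_(_ < k | _) _; have : 0 <= X by apply: sumr_ge0 => l _; apply: sqr_ge0.
  move: Uis; set x := U i s; set y := U j s => x0 X0 E.
  have x1 := sqr_ge1 x0; have := sqr_ge0 y => y0.
  by apply/eqP; rewrite -sqrf_eq0; apply/eqP; lia.
have fE a b : dotr (row a U) (row b U) = (a == b)%:R * 2.
  by rewrite -row_dotr fU !mxE; case: (a == b); rewrite ?mul1r ?mul0r.
have [p [q [a [b [pq a1 b1 rE]]]]] : exists s t a b,
    [/\ s != t, a ^+ 2 = 1, b ^+ 2 = 1 & row i U = a *: evec s + b *: evec t].
  by apply: norm2_units; rewrite fE eqxx mul1r.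
have [s' [a' [b' [ss a1' b1' rE']]]] : exists t a b,
    [/\ s != t, a ^+ 2 = 1, b ^+ 2 = 1 & row i U = a *: evec s + b *: evec t].
  have : row i U 0 s != 0 by rewrite mxE.
  rewrite rE !mxE !eqxx /=; case: (eqVneq s p) => [->|_]; first by exists q, a, b.
  case: (eqVneq s q) => [->|_]; last by rewrite !mulr0 addr0 eqxx.
  by exists p, b, a; rewrite eq_sym pq addrC.
pose r : 'rV[int]_N := a' *: evec s - b' *: evec s'.
have dr v : dotr r v = a' * v 0 s - b' * v 0 s' by rewrite dotrBl !dotrZl !dotr_unit.
have ne : s' == s = false by rewrite eq_sym (negPf ss).
have rr : dotr r r = 2.
  rewrite dr /r !mxE !eqxx ne (negPf ss) /= !mulr0 !mulr1 subr0 sub0r mulrN opprK -!expr2.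
  by rewrite a1' b1'.
have rU j : dotr r (row j U) = 0.
  have [->|ji] := eqVneq j i.
    rewrite dr rE' !mxE !eqxx ne (negPf ss) /= !mulr0 !mulr1 addr0 add0r -!expr2.
    by rewrite a1' b1'.
  rewrite dr !mxE others // mulr0 sub0r.
  have : dotr (row i U) (row j U) = 0 by rewrite fE eq_sym (negPf ji) mul0r.
  by rewrite rE' dotrDl !dotrZl !dotr_unit !mxE others // mulr0 add0r => ->; rewrite oppr0.
exists r; rewrite /frame tr_col_mx mul_col_row fU.
have -> : U *m r^T = 0.
  apply/matrixP => j l; rewrite ord1 [RHS]mxE; apply: etrans (rU j); rewrite dotrC mxE.
  by apply: eq_bigr => u _; rewrite !mxE.
have -> : r *m U^T = 0.
  apply/matrixP => l j; rewrite ord1 [RHS]mxE; apply: etrans (rU j); rewrite mxE.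
  by apply: eq_bigr => u _; rewrite !mxE.
have -> : r *m r^T = 2%:M.
  apply/matrixP => l j; rewrite !ord1 [RHS]mxE eqxx mulr1n; apply: etrans rr; rewrite mxE.
  by apply: eq_bigr => u _; rewrite !mxE.
by rewrite -scalar_mx_block.
Qed.

(** A coordinate covered exactly once admits a further row, and this stops because a frame has at
    most [N] rows. *)
Lemma frame_complete k (U : 'M[int]_(k, N)) : frame U ->
  exists m (V : 'M[int]_(m, N)) (f : 'I_k -> 'I_m),
    [/\ frame V, forall s, cover V s s != 1, injective f & forall i, row (f i) V = row i U].
Proof.
have [h] := ubnP (N - k); elim: h k U => // h IH k U hk fU.
case: (pickP (fun s => cover U s s == 1)) => [s /eqP c1|none]; last first.
  by exists k, U, id; split=> // u; rewrite none.
have [r fr] := frame_extend fU c1; have := frame_size fr => kN.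
have [|m [V [f [fV cV finj fE]]]] := IH _ _ _ fr; first by move: hk kN; rewrite addn1; lia.
exists m, V, (f \o lshift 1); split=> //; first by apply: inj_comp finj _; apply: lshift_inj.
by move=> i; rewrite /= fE; apply/rowP => u; rewrite mxE col_mxEu [RHS]mxE.
Qed.

(* Two copies of a frame are completed with the vectors [(e_s, e_s)] and [(e_s, - e_s)] for the
   coordinates [s] covered by no row. *)
Lemma double_frame k (U : 'M[int]_(k, N)) : frame U ->
  exists m (V : 'M[int]_(m, N + N)) (f : 'I_k -> 'I_m),
    [/\ V *m V^T = 2%:M, V^T *m V = 2%:M, injective f &
     forall i, row (f i) V = row_mx (row i U) 0].
Proof.
move=> /frame_complete[m [V [f [fV cV finj fE]]]].
pose Z := [set s | cover V s s == 0].
pose D : 'M[int]_(#|Z|, N) := \matrix_(i, s) (enum_val i == s)%:R.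
have c02 s : cover V s s = if s \in Z then 0 else 2.
  by rewrite inE; have := cover_le2 s fV; have /eqP := cV s; case: eqP => [->//|]; lia.
have V0 s i : s \in Z -> V i s = 0.
  move=> sZ; have := c02 s; rewrite sZ cover_diag => /psumr_eq0P h.
  by apply/eqP; rewrite -sqrf_eq0; apply/eqP/h => // j _; apply: sqr_ge0.
have cE : cover V = 2 *: 1%:M - 2 *: (D^T *m D).
  have DD s t : (D^T *m D) s t = ((s == t) && (s \in Z))%:R.
    rewrite !mxE; case: (boolP (s \in Z)) => sZ.
      rewrite (bigD1 (enum_rank_in sZ s)) //= !mxE enum_rankK_in // eqxx mul1r andbT.
      rewrite big1 ?addr0 // => i ne; rewrite !mxE (_ : (enum_val i == s) = false) ?mul0r //.
      by apply: contraNF ne => /eqP es; apply/eqP/enum_val_inj; rewrite enum_rankK_in.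
    rewrite andbF big1 // => i _; rewrite !mxE (_ : (enum_val i == s) = false) ?mul0r //.
    by apply: contraNF sZ => /eqP <-; apply: enum_valP.
  apply/matrixP => s t; rewrite [RHS]mxE [X in _ = X + _]mxE [X in _ = _ + X]mxE [X in _ = _ - X]mxE DD.
  rewrite [X in _ = _ * X - _]mxE; case: (boolP (s \in Z)) => sZ.
    rewrite andbT subrr /cover mxE big1 // => i _.
    by rewrite [X in X * _]mxE V0 // mul0r.
  rewrite andbF mulr0 subr0; have [<-|st] := eqVneq s t; first by rewrite c02 (negPf sZ) mulr1.
  (* The diagonal entry 2 already accounts for the whole sum of squares, 4, of its row. *)
  rewrite mulr0; have := cover_sqr s fV; rewrite (bigD1 s) //= (bigD1 t) 1?eq_sym //=.
  rewrite c02 (negPf sZ); set X := \sum_(_ < N | _) _ => E.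
  have X0 : 0 <= X by apply: sumr_ge0 => i _; apply: sqr_ge0.
  have c0 := sqr_ge0 (cover V s t).
  by apply/eqP; rewrite -sqrf_eq0; apply/eqP; lia.
have DDt : D *m D^T = 1%:M.
  apply/matrixP => i j; rewrite !mxE (bigD1 (enum_val i)) //= big1 ?addr0 => [|s /negPf ne].
    by rewrite !mxE eqxx mul1r (inj_eq enum_val_inj) eq_sym.
  by rewrite !mxE eq_sym ne mul0r.
have VD : V *m D^T = 0.
  apply/matrixP => i j; rewrite !mxE big1 // => s _; rewrite !mxE.
  by case: eqP => [<-|_]; rewrite ?mulr0 // V0 ?mul0r // enum_valP.
have DV : D *m V^T = 0 by rewrite -[LHS]trmxK trmx_mul trmxK VD trmx0.
have trN : (- D)^T = - D^T by apply/matrixP => i j; rewrite !mxE.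
have two l : 1%:M + 1%:M = 2%:M :> 'M[int]_l.
  by apply/matrixP => i j; rewrite !mxE -mulrnDl.
pose V2 := col_mx (block_mx V 0 0 V) (block_mx D D D (- D)).
exists (m + m + (#|Z| + #|Z|))%N, V2, (fun i => lshift _ (lshift _ (f i))); split.
- rewrite /V2 tr_col_mx mul_col_row !tr_block_mx !mulmx_block !trmx0 trN.
  rewrite !mulmx0 !mul0mx !addr0 !add0r !mulmxN !mulNmx fV VD DV DDt !oppr0 opprK subrr.
  by rewrite !two !block_mx0 -!scalar_mx_block.
- rewrite /V2 tr_col_mx mul_row_col !tr_block_mx !mulmx_block !trmx0 trN.
  rewrite !mulmx0 !mul0mx !addr0 !add0r !mulmxN !mulNmx !opprK -/(cover V) cE subrr.
  rewrite add_block_mx !addr0 -[X in _ + (X + _)]scale1r -[X in _ + (_ + X)]scale1r -scalerDl.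
  by rewrite subrK scale_scalar_mx mulr1 -scalar_mx_block.
- by move=> i j /lshift_inj/lshift_inj/finj.
move=> i; apply/rowP => s; rewrite /V2 mxE col_mxEu; case: (split_ordP s) => u ->.
  by rewrite block_mxEul row_mxEl -fE mxE.
by rewrite block_mxEur row_mxEr !mxE.
Qed.

(** With [P2] acting as [P] on both copies of the space, the square of [V P2 V^T] is
    [V P2 (V^T V) P2 V^T = 2 V V^T = 4]. *)
Lemma repr_embeds n (U : 'M[int]_(n, N)) (P : 'M[int]_N) : frame U -> P^T = P -> P *m P = 1%:M ->
  exists m (B : 'M[int]_m) (f : 'I_n -> 'I_m),
    [/\ B^T = B, B *m B = 4%:M, injective f &
     forall i j, B (f i) (f j) = (U *m P *m U^T) i j].
Proof.
move=> fU sP P1; have [m [V [f [VV VV' finj fE]]]] := double_frame fU.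
pose P2 := block_mx P 0 0 P.
have sP2 : P2^T = P2 by rewrite /P2 tr_block_mx sP !trmx0.
have P21 : P2 *m P2 = 1%:M.
  by rewrite /P2 mulmx_block !mulmx0 !mul0mx !addr0 !add0r P1 -scalar_mx_block.
exists m, (V *m P2 *m V^T), f; split=> //.
- by rewrite !trmx_mul trmxK sP2 mulmxA.
- rewrite !mulmxA -(mulmxA (V *m P2) V^T V) VV' mul_mx_scalar -!scalemxAl -(mulmxA V) P21 mulmx1.
  by rewrite VV scale_scalar_mx.
move=> i j; rewrite (mulmx3_row V) !fE /P2 mul_row_block !mulmx0 !mul0mx !addr0.
by rewrite tr_row_mx mul_row_col trmx0 mulmx0 addr0 -mulmx3_row.
Qed.
End Frame.

Lemma dotr_row_mx m n (a c : 'rV[int]_m) (b d : 'rV[int]_n) :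
  dotr (row_mx a b) (row_mx c d) = dotr a c + dotr b d.
Proof.
rewrite /dotr big_split_ord /=.
by congr (_ + _); apply: eq_bigr => s _; rewrite ?row_mxEl ?row_mxEr.
Qed.

(** * Embedding large integral matrices *)

Section IntegerEmbedding.
Variables (n : nat) (A : 'M[int]_n).
Hypothesis symA : A^T = A.
Hypothesis contrA : forall x : 'I_n -> int,
  \sum_i (\sum_j A i j * x j) ^+ 2 <= 4 * \sum_i x i ^+ 2.
Definition adjA : rel 'I_n := fun i j => (i != j) && (A i j != 0).
Hypothesis connA : forall i j, connect adjA i j.
Hypothesis largeA : (5 ^ 7 + 10 < n)%N.

Lemma symAE i j : A i j = A j i. Proof. by rewrite -{1}symA mxE. Qed.

Lemma row_le4 i : \sum_j A i j ^+ 2 <= 4.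
Proof.
have := contrA (fun j => (j == i)%:R).
have -> : \sum_j (j == i)%:R ^+ 2 = 1 :> int.
  rewrite (bigD1 i) //= eqxx expr1n big1 ?addr0 // => j /negPf ->.
  by rewrite expr0n.
rewrite mulr1; apply: le_trans; rewrite le_eqVlt; apply/orP; left; apply/eqP.
apply: eq_bigr => j _; congr (_ ^+ 2).
rewrite (bigD1 i) //=.
rewrite eqxx mulr1.
rewrite big1 ?addr0; first exact: symAE.
by move=> k /negPf ->; rewrite mulr0.
Qed.

(** An entry of absolute value at least 2 exhausts the norm 4 of its row. By symmetry [i] and [j]
    would then form a component on their own, which is too small. *)
Lemma entry_sqr1 i j : A i j != 0 -> A i j ^+ 2 = 1.
Proof.
move=> Aij; have le4 := row_le4.
have only a b : A a b != 0 -> A a b ^+ 2 != 1 -> forall c, c != b -> A a c = 0.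
  move=> ab0 ab1 c cb; have := le4 a; rewrite (bigD1 b) //= (bigD1 c) //=.
  set X := \sum_(_ < n | _) _ => h.
  have X0 : 0 <= X by apply: sumr_ge0 => l _; apply: sqr_ge0.
  have c0 := sqr_ge0 (A a c).
  have ab4 : 4 <= A a b ^+ 2.
    move: ab0 ab1; rewrite sqrf_eq1 negb_or expr2; set x := A a b => x0 /andP[x1 x2].
    have [h2|h2] : x <= -2 \/ 2 <= x by lia.
      have := ler_pM (_ : 0 <= 2) (_ : 0 <= 2) (_ : 2 <= - x) (_ : 2 <= - x); lia.
    by have := ler_pM (_ : 0 <= 2) (_ : 0 <= 2) h2 h2; lia.
  by apply/eqP; rewrite -sqrf_eq0; apply/eqP; lia.
apply/eqP; apply: contraT => ne1; exfalso.
have oi := only i j Aij ne1.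
have oj : forall c, c != i -> A j c = 0 by apply: only; rewrite symAE.
have [u] : exists u, u \notin [set i; j].
  apply/existsP; rewrite -negb_forall; apply/negP => /forallP h.
  have : (n <= #|[set i; j]|)%N.
    by rewrite -[X in (X <= _)%N]card_ord; apply/subset_leq_card/subsetP => u _.
  by rewrite cards2; lia.
have clo : closed adjA [set i; j].
  apply: intro_closed; first by apply: sym_connect_sym => a b; rewrite /adjA eq_sym symAE.
  move=> a b /andP[ab nz]; rewrite !inE => /orP[] /eqP E; subst a.
    by case: (eqVneq b j) nz => [->|bj]; rewrite ?eqxx ?orbT // oi ?eqxx.
  by case: (eqVneq b i) nz => [->|bj]; rewrite ?eqxx // oj ?eqxx.
by have := closed_connect clo (connA i u); rewrite set21 => <-.
Qed.

Lemma card_nbrs i : (#|[set j | A i j != 0%R]| <= 4)%N.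
Proof.
have : \sum_(j in [set j | A i j != 0]) 1 <= \sum_j A i j ^+ 2.
  rewrite big_mkcond; apply: ler_sum => j _; rewrite inE.
  by case: ifP => [/sqr_ge1//|_]; apply: sqr_ge0.
by rewrite sumr_const natz => h; have := le_trans h (row_le4 i).
Qed.

Definition embeds := exists m (B : 'M[int]_m) (f : 'I_n -> 'I_m),
    [/\ B^T = B, B *m B = 4%:M, injective f & forall i j, B (f i) (f j) = A i j].

(** Complete the square: [|2 u + A w| ^ 2 >= 0] and [|A w| ^ 2 <= 4 |w| ^ 2]. *)
Lemma quad_sqr (u w : 'I_n -> int) :
  0 <= \sum_i u i ^+ 2 + \sum_i u i * (\sum_j A i j * w j) + \sum_i w i ^+ 2.
Proof.
have : 0 <= \sum_i (2 * u i + \sum_j A i j * w j) ^+ 2.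
  by apply: sumr_ge0 => i _; apply: sqr_ge0.
have -> : \sum_i (2 * u i + \sum_j A i j * w j) ^+ 2 =
    4 * \sum_i u i ^+ 2 + 4 * \sum_i u i * (\sum_j A i j * w j) + \sum_i (\sum_j A i j * w j) ^+ 2.
  by rewrite !mulr_sumr -!big_split; apply: eq_bigr => i _ /=; ring.
have := contrA w; set a := \sum_i u i ^+ 2; set b := \sum_i _; set c := \sum_i w i ^+ 2.
set d := \sum_i _; lia.
Qed.

Definition dbl := ('I_n * bool)%type.
(* Gram matrix of [2n] vectors [a_i = (i, false)] and [b_i = (i, true)] with
   [(a_i, a_j) = (b_i, b_j) = 2 delta_ij] and [(a_i, b_j) = A i j]: doubling removes the charges. *)
Definition gramD (x y : dbl) : int := if x.2 == y.2 then (x.1 == y.1)%:R * 2 else A x.1 y.1.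
Definition swap (x : dbl) : dbl := (x.1, ~~ x.2).

Lemma swapK : involutive swap.
Proof. by move=> [i b]; rewrite /swap /= negbK. Qed.

Lemma sum_dbl (F : dbl -> int) : \sum_x F x = \sum_i (F (i, false) + F (i, true)).
Proof.
transitivity (\sum_(x : dbl) F (x.1, x.2)); first by apply: eq_bigr => -[].
rewrite -(pair_bigA _ (fun i b => F (i, b))) /=.
by apply: eq_bigr => i _; rewrite big_bool addrC.
Qed.

Lemma gramD_sym x y : gramD x y = gramD y x.
Proof. by rewrite /gramD eq_sym [y.1 == x.1]eq_sym symAE. Qed.

Lemma gramD_psd (y : dbl -> int) : 0 <= \sum_i \sum_j y i * y j * gramD i j.
Proof.
pose u i := y (i, false); pose w i := y (i, true).
have -> : \sum_i \sum_j y i * y j * gramD i j =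
   2 * (\sum_i u i ^+ 2 + \sum_i u i * (\sum_j A i j * w j) + \sum_i w i ^+ 2).
  have E1 : \sum_i \sum_j y i * y j * gramD i j = \sum_i
      ((u i ^+ 2 * 2 + u i * (\sum_j A i j * w j)) + (w i * (\sum_j A i j * u j) + w i ^+ 2 * 2)).
    rewrite sum_dbl; apply: eq_bigr => i _; rewrite !sum_dbl !big_split /=.
    have dg (x z : 'I_n -> int) b c : b = c -> \sum_j x i * z j * gramD (i, b) (j, c) = x i * z i * 2.
      move=> <-; rewrite /gramD /= eqxx (bigD1 i) //= eqxx mul1r big1 ?addr0 // => j /negPf ji.
      by rewrite eq_sym ji mul0r mulr0.
    have og (x z : 'I_n -> int) b c : (b == c) = false ->
        \sum_j x i * z j * gramD (i, b) (j, c) = x i * \sum_j A i j * z j.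
      by move=> bc; rewrite /gramD /= bc mulr_sumr; apply: eq_bigr => j _; ring.
    by rewrite (dg u u) // (dg w w) // (og u w) // (og w u) // !expr2.
  rewrite E1 !big_split /= -!mulr_suml.
  have -> : \sum_i w i * (\sum_j A i j * u j) = \sum_i u i * (\sum_j A i j * w j).
    under eq_bigr do rewrite mulr_sumr.
    rewrite exchange_big; apply: eq_bigr => i _; rewrite mulr_sumr.
    by apply: eq_bigr => j _; rewrite symAE; ring.
  by ring.
by rewrite mulr_ge0 // quad_sqr.
Qed.

(** The vectors [a_i] form the frame. Exchanging every [a_i] with [b_i] preserves the Gram matrix,
    hence is given by a symmetric involution [P], and [A i j = (a_i, b_j) = (a_i, a_j P)]. *)
Lemma embeds_of_connected : (forall x y, connect (adjG gramD) x y) -> embeds.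
Proof.
move=> conn.
have [||t||g [S rG]] := @full_repr dbl gramD gramD_sym _ gramD_psd _ conn 4.
- by move=> x; rewrite /gramD !eqxx mul1r.
- move=> x y xy; rewrite /gramD; case: ifP => [/eqP e2|_ /entry_sqr1 //].
  by rewrite (_ : x.1 == y.1 = false) ?mul0r ?eqxx //; apply: contraNF xy; case: x y e2 => [i b] [j c] /= -> /eqP ->.
- case: t => k c; apply: leq_trans (card_nbrs k).
  rewrite -(card_imset _ (_ : injective (fun j : 'I_n => (j, ~~ c)))); last by move=> a b [].
  apply/subset_leq_card/subsetP => -[j b]; rewrite !inE /adjG /gramD /= xpair_eqE.
  case: (eqVneq c b) => [->|cb]; last first.
    rewrite andbF /= => nz; apply/imsetP; exists j; rewrite ?inE //; congr (_, _).
    by case: c b cb => -[].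
  by rewrite andbT => /andP[/negPf ->]; rewrite mul0r eqxx.
- by rewrite card_prod card_ord card_bool; lia.
have swapG x y : gramD (swap x) (swap y) = gramD x y.
  by rewrite /gramD /swap /=; case: x.2; case: y.2.
have [P [sP P1 gP]] := automorphism_mx rG swapK swapG.
have [gG _ _ _ _] := rG.
pose U : 'M[int]_(n, #|{: dbl}|.+1) := \matrix_i g (i, false).
have rowU i : row i U = g (i, false) by rewrite rowK.
have fU : frame U.
  apply/matrixP => i j; rewrite row_dotr !rowU gG ?inE // /gramD /= mxE.
  by case: (i == j); rewrite ?mul1r ?mul0r.
have [m [B [f [sB B4 finj fB]]]] := repr_embeds fU sP P1.
exists m, B, f; split=> // i j; rewrite fB.
have -> : A i j = dotr (g (i, false)) (g (swap (j, false))) by rewrite gG ?inE.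
rewrite gP mulmx3_row !rowU -mulmxA mxE; apply: eq_bigr => s _; congr (_ * _).
have -> : P *m (g (j, false))^T = (g (j, false) *m P)^T by rewrite trmx_mul sP.
by rewrite mxE.
Qed.

(** Here [A] has no charges and [2 + A] is itself the Gram matrix of a connected system of roots.
    Roots of the same colour are orthogonal; placing the two colours in two orthogonal copies of the
    space gives a frame, and the matrix [P] exchanging the copies restores the inner products
    between colours. *)
Lemma embeds_of_bipartite (kappa : 'I_n -> bool) :
  (forall i j, A i j != 0 -> kappa i != kappa j) -> embeds.
Proof.
move=> bip.
pose G i j := (i == j)%:R * 2 + A i j.
have A0 i j : kappa i = kappa j -> A i j = 0.
  by move=> kij; apply/eqP; apply: contraT => /bip; rewrite kij eqxx.
have Gne i j : i != j -> G i j = A i j by move=> /negPf ij; rewrite /G ij mul0r add0r.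
have [|||||t||g [S rG]] := @full_repr 'I_n G _ _ _ _ _ 4.
- by move=> i j; rewrite /G eq_sym symAE.
- by move=> i; rewrite /G eqxx A0 // mul1r addr0.
- move=> y; have -> : \sum_i \sum_j y i * y j * G i j =
     \sum_i y i ^+ 2 + \sum_i y i * (\sum_j A i j * y j) + \sum_i y i ^+ 2.
    rewrite -!big_split; apply: eq_bigr => i _ /=.
    rewrite (eq_bigr (fun j => (j == i)%:R * (y i * y j * 2) + y i * (A i j * y j))).
      by rewrite big_split -!mulr_sumr sum_indic /=; ring.
    by move=> j _; rewrite /G eq_sym; ring.
  exact: quad_sqr.
- by move=> i j ij; rewrite Gne //; apply: entry_sqr1.
- move=> i j; apply: connect_sub (connA i j) => x y /andP[xy Axy].
  by apply: connect1; rewrite /adjG xy Gne.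
- apply: leq_trans (card_nbrs t); apply/subset_leq_card/subsetP => j.
  by rewrite !inE => /andP[tj]; rewrite Gne.
- by rewrite card_ord.
have [gG _ _ _ _] := rG.
pose U : 'M[int]_(n, #|{: 'I_n}|.+1 + #|{: 'I_n}|.+1) :=
  \matrix_i (if kappa i then row_mx 0 (g i) else row_mx (g i) 0).
pose P : 'M[int]_(#|{: 'I_n}|.+1 + #|{: 'I_n}|.+1) := block_mx 0 1%:M 1%:M 0.
have rowU i : row i U = if kappa i then row_mx 0 (g i) else row_mx (g i) 0 by rewrite rowK.
have gE i j : dotr (g i) (g j) = G i j by rewrite gG ?inE.
have fU : frame U.
  apply/matrixP => i j; rewrite row_dotr !rowU [RHS]mxE.
  have [<-|ij] := eqVneq i j.
    by case: (kappa i); rewrite dotr_row_mx !dot0r ?add0r ?addr0 gE /G eqxx A0 // addr0.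
  case ki: (kappa i); case kj: (kappa j); rewrite dotr_row_mx ?dot0r ?[dotr _ 0]dotrC ?dot0r ?addr0 ?add0r //.
    by rewrite gE Gne // A0 // ki kj.
  by rewrite gE Gne // A0 // ki kj.
have sP : P^T = P by rewrite /P tr_block_mx !trmx0 !trmx1.
have P1 : P *m P = 1%:M.
  by rewrite /P mulmx_block !mulmx0 !mul0mx !mulmx1 !addr0 !add0r -scalar_mx_block.
have [m [B [f [sB B4 finj fB]]]] := repr_embeds fU sP P1.
exists m, B, f; split=> // i j; rewrite fB mulmx3_row !rowU.
have swapP a b : row_mx a b *m P = row_mx b a :> 'rV[int]_(#|{: 'I_n}|.+1 + #|{: 'I_n}|.+1).
  by rewrite /P mul_row_block !mulmx0 !mulmx1 add0r addr0.
have ent M (v w : 'rV[int]_M) : (v *m w^T) 0 0 = dotr v w.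
  by rewrite mxE; apply: eq_bigr => s _; rewrite mxE.
case ki: (kappa i); case kj: (kappa j); rewrite swapP ent dotr_row_mx ?dot0r ?[dotr _ 0]dotrC ?dot0r ?addr0 ?add0r.
- by rewrite A0 // ki kj.
- rewrite gE Gne //; by apply/eqP => ij; rewrite ij kj in ki.
- rewrite gE Gne //; by apply/eqP => ij; rewrite ij kj in ki.
by rewrite A0 // ki kj.
Qed.

(** The graph of [gramD] is the bipartite double cover of the graph of [A], in which a charge joins
    the two copies of its vertex. If the component of [x0] contains both copies of some vertex, it
    is everything. Otherwise it contains exactly one copy of each vertex, and this choice is a
    proper 2-colouring. *)
Theorem integer_embeds : embeds.
Proof.
have n0 : (0 < n)%N by apply: leq_ltn_trans largeA.
pose x0 : dbl := (Ordinal n0, false).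
pose r := adjG gramD.
have symr : connect_sym r by apply: sym_connect_sym => x y; rewrite /r /adjG eq_sym gramD_sym.
have edge i j b : A i j != 0 -> connect r (i, b) (j, ~~ b).
  move=> Aij; apply: connect1; rewrite /r /adjG /gramD /= xpair_eqE.
  by case: b; rewrite /= andbF.
have step x y : r x y -> connect r (swap x) (swap y).
  move=> /andP[xy Gxy]; apply: connect1; apply/andP; split.
    by rewrite (inj_eq (can_inj swapK)).
  by move: Gxy; rewrite /gramD /swap /=; case: x.2; case: y.2.
have swc x y : connect r x y -> connect r (swap x) (swap y).
  move=> /connectP[p]; elim: p x => [|z p IH] x /=; first by move=> _ ->.
  by move=> /andP[/step h1 pz] yE; apply: connect_trans h1 (IH z pz yE).
have lift i : exists b, connect r x0 (i, b).
  have /connectP[p] := connA (Ordinal n0) i.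
  have : exists b, connect r x0 (Ordinal n0, b) by exists false.
  elim: p (Ordinal n0) => [|z p IH] j /=; first by move=> h _ ->.
  move=> [b hb] /andP[/andP[_ Ajz] pz]; apply: IH pz.
  by exists (~~ b); apply: connect_trans hb (edge _ _ _ Ajz).
case: (boolP [exists j, connect r x0 (j, false) && connect r x0 (j, true)]) => [/existsP[j /andP[jf jt]]|no].
  apply: embeds_of_connected => x y.
  have x0s : connect r x0 (swap x0).
    by apply: connect_trans jt _; rewrite symr; apply: (swc x0 (j, false)).
  have all z : connect r x0 z.
    case: z => i b; have [c hc] := lift i.
    have [->//|bc] := eqVneq b c.
    have -> : (i, b) = swap (i, c) by rewrite /swap /=; case: b c bc {hc} => -[].
    exact: connect_trans x0s (swc _ _ hc).
  by apply: connect_trans (all y); rewrite symr.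
apply: (embeds_of_bipartite (kappa := fun i => connect r x0 (i, true))) => i j Aij.
have nb k : ~~ (connect r x0 (k, false) && connect r x0 (k, true)).
  by apply: contra no => h; apply/existsP; exists k.
have [[] hb] := lift i.
  rewrite hb; have hf := connect_trans hb (edge i j true Aij).
  by apply/eqP => /esym jt; have := nb j; rewrite hf jt.
have ht := connect_trans hb (edge i j false Aij); rewrite ht.
by apply/eqP => it; have := nb i; rewrite hb it.
Qed.
End IntegerEmbedding.

(** * Components of matrices with square 4 *)

Section Component.
Variables (R : rcfType) (m : nat) (B : 'M[R]_m) (u0 : 'I_m).
Hypotheses (ZB : over_Zphi B) (symB : B^T = B) (B4 : B *m B = 4%:M).
Let K := [set u | connect (mx_adj B) u0 u].

Lemma component_root : u0 \in K. Proof. by rewrite inE. Qed.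
Let rk := enum_rank_in component_root.

Definition component_mx : 'M[R]_#|K| := \matrix_(i, j) B (enum_val i) (enum_val j).

Lemma component_out u v : u \in K -> v \notin K -> B u v = 0.
Proof.
move=> uK vK; apply/eqP; apply: contraNT vK => nz.
have [<-//|uv] := eqVneq u v.
move: uK; rewrite !inE => cu; apply: (connect_trans cu); apply: connect1.
by rewrite /mx_adj uv.
Qed.

(** The matrix obtained from a completed frame may be decomposable. Entries leading out of a
    component vanish, so the component again has square 4. *)
Lemma component_maximal : maximal_indec_cyc_Zphi component_mx.
Proof.
have symC : component_mx^T = component_mx.
  by apply/matrixP => i j; rewrite !mxE -{1}symB mxE.
apply: maximal_sqr4 => //.
- by move=> i j; rewrite mxE; apply: ZB.
- split; first by apply/card_gt0P; exists u0; apply: component_root.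
  have c0 u : u \in K -> connect (mx_adj component_mx) (rk u0) (rk u).
    have gen p x : connect (mx_adj component_mx) (rk u0) (rk x) -> x \in K ->
        path (mx_adj B) x p -> connect (mx_adj component_mx) (rk u0) (rk (last x p)).
      elim: p x => [|z p IH] x cx xK //= /andP[xz pz].
      have zK : z \in K.
        by apply: contraTT xz => zK; rewrite /mx_adj component_out // eqxx andbF.
      apply: IH => //; apply: (connect_trans cx); apply: connect1.
      move: xz; rewrite /mx_adj mxE !enum_rankK_in // => /andP[xz ->]; rewrite andbT.
      by apply: contra xz => /eqP/(congr1 enum_val); rewrite !enum_rankK_in // => ->.
    rewrite inE => /connectP[p pp ->]; apply: gen pp; first exact: connect0.
    exact: component_root.
  move=> i j; have e l : l = rk (enum_val l) by rewrite /rk enum_valK_in.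
  rewrite (e i) (e j); apply: connect_trans (c0 _ (enum_valP j)).
  by rewrite (sym_connect_sym (mx_adj_sym symC)) c0 // enum_valP.
apply/matrixP => i j; rewrite mxE.
have /matrixP/(_ (enum_val i) (enum_val j)) := B4.
rewrite !mxE (inj_eq enum_val_inj) => <-.
rewrite [RHS](bigID (mem K)) /= [X in _ = _ + X]big1 ?addr0; last first.
  by move=> v vK; rewrite component_out ?mul0r // enum_valP.
by rewrite [RHS]big_enum_val; apply: eq_bigr => v _; rewrite !mxE.
Qed.

Lemma component_sub n (A : 'M[R]_n) (f : 'I_n -> 'I_m) : injective f ->
  (forall i, f i \in K) -> (forall i j, A i j = B (f i) (f j)) -> principal_sub A component_mx.
Proof.
move=> finj fK AE; exists (rk \o f); split.
  by move=> i j /(congr1 enum_val); rewrite !enum_rankK_in // => /finj.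
by apply/matrixP => i j; rewrite !mxE !enum_rankK_in.
Qed.
End Component.

Section Final.
Variable R : rcfType.

Lemma integer_in_maximal n (A : 'M[R]_n) : (5 ^ 7 + 10 < n)%N -> indec_cyc_Zphi A -> over_Z A ->
  exists m (B : 'M[R]_m), maximal_indec_cyc_Zphi B /\ principal_sub A B.
Proof.
move=> n_large [_ [[n0 cA] cycA]] ZA.
have /fin_all_exists[a aP] : forall ij : 'I_n * 'I_n, exists z : int, A ij.1 ij.2 = z%:~R.
  by move=> [i j]; have [z ->] := ZA i j; exists z.
pose C : 'M[int]_n := \matrix_(i, j) a (i, j).
have AE i j : A i j = (C i j)%:~R by rewrite mxE (aP (i, j)).
have [symA _] := cycA; have c2 := cyclotomic_contraction2 cycA.
have symC : C^T = C.
  by apply/matrixP => i j; apply/eqP; rewrite -(eqr_int R) mxE -!AE -{1}symA mxE.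
have contrC (x : 'I_n -> int) : \sum_i (\sum_j C i j * x j) ^+ 2 <= 4 * \sum_i x i ^+ 2.
  rewrite -(ler_int R); have := c2 (\col_i (x i)%:~R); rewrite !nsqE.
  rewrite rmorphM !rmorph_sum /=; congr (_ <= _).
    apply: eq_bigr => i _; rewrite rmorphXn rmorph_sum !mxE /=; congr (_ ^+ 2).
    by apply: eq_bigr => j _; rewrite mxE rmorphM /= AE.
  by congr (_ * _); apply: eq_bigr => i _; rewrite mxE rmorphXn.
have Cne i j : (C i j != 0) = (A i j != 0) by rewrite AE intr_eq0.
have connC i j : connect (adjA C) i j.
  by apply: connect_sub (cA i j) => x y /andP[xy Axy]; apply: connect1; rewrite /adjA xy Cne.
have [m [B [f [symB B4 finj fB]]]] := integer_embeds symC contrC connC n_large.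
pose B' := imx R B.
have symB' : B'^T = B' by apply/matrixP => i j; rewrite !mxE -{1}symB mxE.
have B4' : B' *m B' = 4%:M.
  apply/matrixP => i j; have /matrixP/(_ i j) := B4; rewrite !mxE => /(congr1 (intr : int -> R)).
  rewrite rmorph_sum rmorphMn /= => <-; apply: eq_bigr => k _.
  by rewrite !mxE rmorphM.
have ZB' : over_Zphi B'.
  by move=> i j; exists (B i j), 0; rewrite mxE mul0r addr0.
pose i0 := Ordinal n0.
have AB i j : A i j = B' (f i) (f j) by rewrite AE [RHS]mxE fB.
exists _, (component_mx B' (f i0)); split; first exact: component_maximal.
apply: (component_sub finj _ AB) => i; rewrite inE.
have /connectP[p] := cA i0 i; elim: p i0 => [|z p IH] x /=; first by move=> _ ->.
move=> /andP[/andP[xz Axz] pz] iE; apply: connect_trans (IH z pz iE); apply: connect1.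
by rewrite /mx_adj (inj_eq finj) xz -AB.
Qed.

Lemma principal_sub_trans n m l (A : 'M[R]_n) (B : 'M[R]_m) (C : 'M[R]_l) :
  principal_sub A B -> principal_sub B C -> principal_sub A C.
Proof.
move=> [f [fi ->]] [g [gi ->]]; exists (g \o f); split; first exact: inj_comp.
by apply/matrixP => i j; rewrite !mxE.
Qed.

Lemma principal_sub_refl n (A : 'M[R]_n) : principal_sub A A.
Proof. by exists id; split=> //; apply/matrixP => i j; rewrite mxE. Qed.

(** If [A] lies in no maximal matrix, every extension of [A] has a proper extension, so there are
    extensions of any size. One beyond the threshold is integral, since irrational ones have at most
    8 vertices, and therefore lies in a maximal matrix, which also contains [A]. *)
Lemma in_maximal n (A : 'M[R]_n) : indec_cyc_Zphi A ->
  exists m (B : 'M[R]_m), maximal_indec_cyc_Zphi B /\ principal_sub A B.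
Proof.
move=> iA; apply: NNPP => no.
have grow N : exists m (C : 'M[R]_m), [/\ indec_cyc_Zphi C, principal_sub A C & (N <= m)%N].
  elim: N => [|N [m [C [iC AC Nm]]]]; first by exists n, A; split=> //; apply: principal_sub_refl.
  apply: NNPP => h; apply: no; exists m, C; split=> //; split=> // -[l [D [iD [ml CD]]]].
  apply: h; exists l, D; split=> //; first exact: principal_sub_trans CD.
  exact: leq_ltn_trans ml.
have [m [C [iC AC Nm]]] := grow (5 ^ 7 + 10).+1.
case: (classic (over_Z C)) => ZC.
  have [l [B [mB CB]]] := integer_in_maximal Nm iC ZC.
  by apply: no; exists l, B; split=> //; apply: principal_sub_trans CB.
by have := leq_trans Nm (noninteger_size iC ZC); rewrite ltnNge addnC.
Qed.
End Final.

Theorem theorem6 (R : rcfType) :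
  (forall (n : nat) (A : 'M[R]_n),
      maximal_indec_cyc_Zphi A -> ~ over_Z A ->
      (mx_equiv A (S3 R) \/ mx_equiv A (S4_1 R) \/ mx_equiv A (S4_2 R) \/
       mx_equiv A (S4_3 R) \/ mx_equiv A (S6 R) \/ mx_equiv A (S8_dagdag R) \/
       mx_equiv A (S8_ddag R))) /\
  (forall (n : nat) (A : 'M[R]_n),
      indec_cyc_Zphi A ->
      exists (m : nat) (B : 'M[R]_m), maximal_indec_cyc_Zphi B /\ principal_sub A B).
Proof.
split=> n A; first exact: noninteger_classification.
exact: in_maximal.
Qed.
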